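(* Let $d$ be a positive integer. Fix a Schwartz function $\eta$ on $\mathbb{R}$ supported in $(-2,2)$ with $\eta\equiv 1$ on $[-1,1]$, put $\phi(\xi)=\eta(\xi)-\eta(2\xi)$, and let $\widetilde\Delta_{k_1,\dots,k_d}$, $k_1,\dots,k_d\in\mathbb{N}_0$, be the associated smooth Littlewood–Paley projections on $\mathbb{T}^d$. There exists a constant $C_d>0$, depending only on the dimension $d$ and the choice of $\phi$, such that $$\|f\|_{L^p(\mathbb{T}^d)}\le C_d\,p^{d/2}\Big(\sum_{k_1,\dots,k_d\in\mathbb{N}_0}\|\widetilde\Delta_{k_1,\dots,k_d}(f)\|_{L^\infty(\mathbb{T}^d)}^2\Big)^{1/2}$$ for every trigonometric polynomial $f$ on $\mathbb{T}^d$ and for each $p>2$.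
   Context: $\mathbb{N}$ is the set of positive integers, $\mathbb{N}_0$ the set of non-negative integers. The torus $\mathbb{T}$ is identified with $[0,1)$ with Lebesgue measure, and $\widehat f(r)=\int_{\mathbb{T}^d}f(x)e^{-i2\pi r\cdot x}\,dx$. For $k\in\mathbb{N}$ set $\phi_k(\xi)=\phi(2^{-k}\xi)$, and for $k=0$ set $\phi_0=\eta$ (so $\sum_{k\in\mathbb{N}_0}\phi_k\equiv 1$ on $\mathbb{R}$). For a trigonometric polynomial $f$ on $\mathbb{T}^d$, $$\widetilde\Delta_{k_1,\dots,k_d}(f)(x_1,\dots,x_d)=\sum_{r_1,\dots,r_d\in\mathbb{Z}}\phi_{k_1}(r_1)\cdots\phi_{k_d}(r_d)\widehat f(r_1,\dots,r_d)e^{i2\pi(r_1x_1+\cdots+r_dx_d)}.$$ *)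

(* Defs.v *)
From HB Require Import structures.
From mathcomp Require Import all_boot all_order all_algebra.
From mathcomp Require Import all_classical all_reals all_analysis.
From mathcomp Require Import complex.

Set Implicit Arguments.
Unset Strict Implicit.
Unset Printing Implicit Defensive.

Import Order.TTheory GRing.Theory Num.Theory.
Import numFieldNormedType.Exports.

Local Open Scope classical_set_scope.
Local Open Scope ring_scope.
Local Open Scope complex_scope.

(* T is [0,1) with Lebesgue measure, as a probability on R concentrated on
   [0,1). *)
Section circle_measure.
Variable R : realType.

Definition circle_measure : set (measurableTypeR R) -> \bar R :=
  mrestr (@lebesgue_measure R) (measurable_itv `[0, 1[%R).

HB.instance Definition _ := Measure.on circle_measure.

Let circle_measure_setT : circle_measure setT = 1%E.
Proof.
by rewrite /circle_measure/= /mrestr setTI lebesgue_measure_itv/= lte_fin ltr01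
  -EFinB subr0.
Qed.

HB.instance Definition _ :=
  Measure_isProbability.Build _ _ _ circle_measure circle_measure_setT.

End circle_measure.

Section torus_measure.
Variable R : realType.
Local Notation RT := (measurableTypeR R).

Definition tuple_cons (n : nat) (p : RT * n.-tuple RT) : n.+1.-tuple RT :=
  [tuple of p.1 :: p.2].

Let measurable_tuple_cons n : measurable_fun setT (@tuple_cons n).
Proof. exact: measurable_cons. Qed.

HB.instance Definition _ n :=
  isMeasurableFun.Build _ _ _ _ (@tuple_cons n) (@measurable_tuple_cons n).

(* d-fold product of circle_measure, transported along
   R * R^n ~ R^(n+1), (x, y) |-> x :: y. *)
Fixpoint torus_measure (d : nat) : probability (d.-tuple RT) R :=
  match d return probability (d.-tuple RT) R with
  | 0 => @dirac _ (0.-tuple RT) [tuple] R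
  | n.+1 => distribution (@circle_measure R \x torus_measure n)%E (@tuple_cons n)
  end.

Lemma torus_measure_box (d : nat) (A : 'I_d -> set RT) :
  (forall i, measurable (A i)) ->
  torus_measure d [set x | forall i, A i (tnth x i)] =
  (\prod_(i < d) lebesgue_measure (A i `&` `[0%R, 1%R[%classic))%E.
Proof.
elim: d A => [|d IH] A mA; first by rewrite big_ord0 /= diracE mem_set//=; case.
rewrite big_ord_recl /= /distribution /pushforward.
set B := [set x : d.-tuple RT | forall i, A (lift ord0 i) (tnth x i)].
rewrite (_ : _ @^-1` _ = A ord0 `*` B); last first.
  apply/seteqP; split => -[x y]/=.
    move=> H; split => [|i]; first exact: (H ord0).
    by have := H (lift ord0 i); rewrite /tuple_cons/= tnthS.
  move=> [H0 H] i; case: (unliftP ord0 i) => [j ->|->]; last exact: H0.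
  by rewrite /tuple_cons/= tnthS; exact: H.
rewrite product_measure1E//.
  by congr (_ * _)%E; exact: (IH (fun i => A (lift ord0 i))).
rewrite (_ : B = \bigcap_(i in [set: 'I_d])
    ((fun x : d.-tuple RT => tnth x i) @^-1` A (lift ord0 i))).
  apply: fin_bigcap_measurable => // i _.
  by rewrite -[X in measurable X]setTI; exact: measurable_tnth.
by apply/seteqP; split => x /= H i => [_|]; [exact: H|exact: (H i I)].
Qed.

End torus_measure.

Section littlewood_paley.
Variable R : realType.

(* Functions on T^d are given by their periodic lifts to R^d; torus_measure
   only sees their values on [0,1)^d. *)
Definition cfun (d : nat) := d.-tuple (measurableTypeR R) -> R[i].

Definition expi (t : R) : R[i] := cos t +i* sin t.

Definition phase (d : nat) (r : d.-tuple int)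
    (x : d.-tuple (measurableTypeR R)) : R :=
  2 * pi * \sum_(j < d) (tnth r j)%:~R * (tnth x j : R).

Definition character (d : nat) (r : d.-tuple int) : cfun d :=
  fun x => expi (phase r x).

Definition trig_poly (d : nat) (f : cfun d) : Prop :=
  exists (S : seq (d.-tuple int)) (c : d.-tuple int -> R[i]),
    forall x, f x = \sum_(r <- S) c r * character r x.

Definition torus_integral (d : nat) (f : cfun d) : R[i] :=
  (\int[torus_measure R d]_x complex.Re (f x)) +i* (\int[torus_measure R d]_x complex.Im (f x)).

Definition fourier_coef (d : nat) (f : cfun d) (r : d.-tuple int) : R[i] :=
  torus_integral (fun x => f x * expi (- phase r x)).

(* L^p(T^d) norm, for p an extended real (p = +oo: essential supremum). *)
Definition torus_norm (d : nat) (p : \bar R) (f : cfun d) : \bar R :=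
  Lnorm (torus_measure R d) p (fun x => (Normc.normc (f x))%:E).

Definition schwartz_real (g : R -> R) : Prop :=
  (forall n x, derivable (derive1n n g) x 1) /\
  (forall m n, exists B : R, forall x, `|x ^+ m * derive1n n g x| <= B).

(* A function R -> C is Schwartz iff its real and imaginary parts are:
   derivatives of complex-valued functions of a real variable are taken
   componentwise. *)
Definition schwartz (g : R -> R[i]) : Prop :=
  schwartz_real (fun t => complex.Re (g t)) /\ schwartz_real (fun t => complex.Im (g t)).

Definition fun_support (g : R -> R[i]) : set R := closure [set t | g t != 0].

Definition lp_phi (eta : R -> R[i]) (xi : R) : R[i] := eta xi - eta (2 * xi).

Definition lp_cutoff (eta : R -> R[i]) (k : nat) (xi : R) : R[i] :=
  if k is 0 then eta xi else lp_phi eta (2 ^- k * xi).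

(* When eta has compact support only finitely many r contribute, so the
   finite-support sum is the full sum over Z^d (it would be 0 otherwise). *)
Definition lp_proj (d : nat) (eta : R -> R[i]) (k : d.-tuple nat)
    (f : cfun d) : cfun d :=
  fun x => \sum_(r \in [set: d.-tuple int])
    (\prod_(j < d) lp_cutoff eta (tnth k j) (tnth r j)%:~R)
      * fourier_coef f r * character r x.

End littlewood_paley.

(* Main.v *)
Require Import Defs.
From HB Require Import structures.
From mathcomp Require Import all_boot all_order all_algebra.
From mathcomp Require Import all_classical all_reals all_analysis.
From mathcomp Require Import complex.
From mathcomp Require Import ring lra zify.
From mathcomp Require Import measurable_realfun ess_sup_inf.

(** The estimate holds because the dyadic martingale differences of [f] obey an
    [L^p] inequality with the sharp growth in [p], and because each
    Littlewood-Paley piece is concentrated on the martingale scale matching its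
    frequency.

    In one variable, let [E_n] be the average over dyadic intervals of length
    [2^-n] and [D_n = E_n - E_(n-1)]. Passing from [E_(n-1) f] to [E_n f] splits
    every interval into halves on which the values are [X + Y] and [X - Y], and
    the two-point inequality ([two_point])
      [(|X + Y|^p + |X - Y|^p) / 2 <= (|X|^2 + 11 p |Y|^2)^(p/2)]
    together with the triangle inequality in [L^(p/2)] ([wnormD]) gives
      [||E_n f||_p^2 <= ||E_(n-1) f||_p^2 + 11 p ||D_n f||_p^2].
    The coefficient of the first term is one, so the steps add up to
    [||f||_p^2 <= 11 p (sum_n ||D_n f||_p^2)] ([wnorm_martingale],
    [gnorm_martingale]). Applying this in each of the [d] variables costs
    [(11 p)^d] and bounds [||f||_p^2] by the sum of the squared norms of all
    iterated differences ([gnorm_iterated]); the square root of [p^d] is the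
    factor [p^(d/2)] of the theorem.

    It remains to bound the iterated differences in the uniform norm. If [g] has
    frequencies of size about [2^k], then [||D_n g|| <= 140 * 2^-|n-k| * ||g||]
    ([dyadic_diff_bound]). On scales finer than [2^-k] this is Bernstein's
    inequality ([bernstein]): [g] hardly changes between neighbouring intervals.
    On coarser scales the oscillations of [g] cancel in the mean over an interval
    ([bsum_bound]), because [g] has no low frequencies: convolving it with a
    low-pass kernel gives zero, so [g] is an average of its own differences.
    Schur's test ([schur_offdiag]) then sums these bounds over [n] and [k], one
    variable after the other ([iterated_square_bound]). The cutoffs enter through
    their supports, which localize the pieces, and through the partition of
    unity, which recovers [f] from them.

    The argument takes place on the grid of points with coordinates [j / 2^N],
    where conditional expectations and convolutions are finite sums. For a
    trigonometric polynomial everything passes to the limit through Riemann sums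
    ([integral_le_mesh], [integral_mesh_mean]): the [L^p] norm is the limit of
    the discrete ones, the Fourier coefficients are recovered from exact
    orthogonality on fine grids ([torus_integral_trig_sum]), and the essential
    supremum bounds the values at all points ([trig_sum_le_esssup]). *)

Set Implicit Arguments.
Unset Strict Implicit.
Unset Printing Implicit Defensive.

Import Order.TTheory GRing.Theory Num.Theory.
Import numFieldNormedType.Exports.

Local Open Scope classical_set_scope.
Local Open Scope ring_scope.

(** * Complex moduli and the two-point inequality *)

Local Notation nm := (@Normc.normc _).

Section normc_facts.
Variable R : realType.
Implicit Types z w : R[i].

Lemma nm_ge0 z : 0 <= nm z.
Proof. by case: z => a b; exact: sqrtr_ge0. Qed.

Lemma nmD z w : nm (z + w) <= nm z + nm w.
Proof. exact: le_normcD. Qed.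

Lemma nmN z : nm (- z) = nm z.
Proof. exact: normcN. Qed.

Lemma nmB z w : nm (z - w) <= nm z + nm w.
Proof. by rewrite -(nmN w) nmD. Qed.

Lemma nmM z w : nm (z * w) = nm z * nm w.
Proof. exact: Normc.normcM. Qed.

Lemma nm0 : nm (0 : R[i]) = 0.
Proof. exact: Normc.normc0. Qed.

Lemma nm_sum (I : Type) (r : seq I) (P : pred I) (F : I -> R[i]) :
  nm (\sum_(i <- r | P i) F i) <= \sum_(i <- r | P i) nm (F i).
Proof.
elim/big_ind2 : _ => //; first by rewrite nm0.
by move=> x1 x2 y1 y2 h1 h2; rewrite (le_trans (nmD _ _))// lerD.
Qed.

Lemma nm_sqr z : nm z ^+ 2 = complex.Re z ^+ 2 + complex.Im z ^+ 2.
Proof. by case: z => a b /=; rewrite sqr_sqrtr// addr_ge0 ?sqr_ge0. Qed.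

Lemma nm_real (x : R) : nm (x%:C)%C = `|x|.
Proof. by rewrite /= expr0n addr0 sqrtr_sqr. Qed.

Lemma nm_nat (n : nat) : nm (n%:R : R[i]) = n%:R.
Proof. by rewrite -(rmorph_nat (real_complex R)) nm_real normr_nat. Qed.

Lemma nmJ z : nm (z^*)%C = nm z.
Proof. by case: z => a b /=; rewrite sqrrN. Qed.

Lemma nmV z : nm z^-1 = (nm z)^-1.
Proof. exact: Normc.normcV. Qed.
End normc_facts.

Section two_point.
Variable R : realType.
Implicit Types a b q u v z : R.

Lemma expR_le_invB1 (t : R) : t < 1 -> expR t <= (1 - t)^-1.
Proof.
move=> t1; rewrite -[t in expR t]opprK expRN lef_pV2 ?posrE ?expR_gt0 ?subr_gt0//.
exact: expR_ge1Dx.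
Qed.

(** The bound propagates from small arguments by the duplication formula
    [cosh (2 w) = 2 (cosh w)^2 - 1 <= (cosh w)^4]. *)
Lemma cosh_le_gauss z : (expR z + expR (- z)) / 2 <= expR (2 * z ^+ 2).
Proof.
have small (w : R) : `|w| <= 2^-1 -> (expR w + expR (- w)) / 2 <= expR (2 * w ^+ 2).
  rewrite ler_norml => /andP[w1 w2].
  have e (t : R) : t <= 2^-1 -> expR t <= 1 + t + 2 * t ^+ 2.
    move=> t12; have t1 : t < 1 by lra.
    apply: (le_trans (expR_le_invB1 t1)).
    rewrite -[leLHS]mul1r ler_pdivrMr; last by lra.
    suff : 0 <= t ^+ 2 * (1 - 2 * t) by nra.
    by rewrite mulr_ge0 ?sqr_ge0//; lra.
  have := e _ w2; have := e (- w); rewrite sqrrN => /(_ ltac:(lra)) h1 h2.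
  by apply: le_trans (expR_ge1Dx _); lra.
suff H n (w : R) : `|w| <= 2^-1 * 2 ^+ n ->
    (expR w + expR (- w)) / 2 <= expR (2 * w ^+ 2).
  pose n := Num.trunc (2 * `|z|); apply: (H n.+1).
  have : 2 * `|z| < n.+1%:R by exact: truncnS_gt.
  have : n.+1%:R <= 2 ^+ n.+1 :> R by rewrite -natrX ler_nat ltnW// ltn_expl.
  by move=> ? ?; lra.
elim: n w => [|n IH] w; first by rewrite expr0 mulr1; exact: small.
move=> hw; have := IH (w / 2).
rewrite normrM (ger0_norm (_ : 0 <= 2^-1))// => /(_ _)/wrap[].
  by rewrite exprS in hw; lra.
set c := _ / 2 => hc.
have ew (x : R) : expR x = expR (x / 2) ^+ 2.
  by rewrite -expRM_natl; congr expR; lra.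
have -> : (expR w + expR (- w)) / 2 = 2 * c ^+ 2 - 1.
  rewrite ew (ew (- w)) /c mulNr.
  have : expR (w / 2) * expR (- (w / 2)) = 1 by rewrite -expRD subrr expR0.
  by move: (expR _) (expR _) => x y xy; lra.
have c0 : 0 <= c by rewrite divr_ge0// addr_ge0// expR_ge0.
apply: (@le_trans _ _ (c ^+ 4)); first by have := sqr_ge0 (c ^+ 2 - 1); lra.
have -> : expR (2 * w ^+ 2) = expR (2 * (w / 2) ^+ 2) ^+ 4.
  by rewrite -expRM_natl; congr expR; lra.
by rewrite lerXn2r// nnegrE expR_ge0.
Qed.

(** When [b] is not small compared to [a / sqrt q] the triangle inequality
    suffices; otherwise both sides are comparable with Gaussians, and the linear
    terms of the two exponentials cancel. *)
Lemma two_point_real q a b B : 1 <= q -> 0 <= a -> 0 <= b -> `|B| <= 2 * a * b ->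
  ((a ^+ 2 + b ^+ 2 + B) `^ q + (a ^+ 2 + b ^+ 2 - B) `^ q) / 2 <=
  (a ^+ 2 + 22 * q * b ^+ 2) `^ q.
Proof.
move=> q1 a0 b0; rewrite ler_norml => /andP[B1 B2].
have q0 : 0 <= q by lra.
have sq : 0 <= (a - b) ^+ 2 by exact: sqr_ge0.
have P1 : 0 <= a ^+ 2 + b ^+ 2 + B by nra.
have P2 : 0 <= a ^+ 2 + b ^+ 2 - B by nra.
have P3 : 0 <= a ^+ 2 + 22 * q * b ^+ 2.
  by rewrite addr_ge0 ?sqr_ge0// mulr_ge0 ?sqr_ge0//; lra.
(* The threshold [20 q] makes the exponents below at most [9 / 20]. *)
have [ab|ab] := leP (a ^+ 2) (20 * q * b ^+ 2).
  have a10 : a <= 10 * q * b.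
    rewrite -(@ler_pXn2r _ 2)// ?nnegrE ?mulr_ge0//.
    rewrite (le_trans ab)// !exprMn ler_wpM2r ?sqr_ge0//.
    by nra.
  have M x : 0 <= x -> x <= a ^+ 2 + 22 * q * b ^+ 2 ->
      x `^ q <= (a ^+ 2 + 22 * q * b ^+ 2) `^ q.
    by move=> x0 hx; apply: ge0_ler_powR.
  have abq : a * b <= 10 * q * b ^+ 2 by rewrite expr2 mulrA ler_wpM2r.
  have bb : b ^+ 2 <= q * b ^+ 2 by rewrite ler_peMl ?sqr_ge0.
  have := M _ P1 ltac:(lra); have := M _ P2 ltac:(lra); lra.
have a_gt0 : 0 < a.
  rewrite lt_neqAle a0 andbT; apply/negP => /eqP a00; move: ab.
  rewrite -a00 expr0n/= ltNge => /negP; apply.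
  by rewrite !mulr_ge0 ?sqr_ge0//; lra.
have a2 : 0 < a ^+ 2 by rewrite exprn_gt0.
(* By homogeneity, compare [1 + u + v] and [1 + u - v] with exponentials, where
   [v ^+ 2 <= 4 * u]. *)
have [u eu] : exists u, b ^+ 2 = a ^+ 2 * u.
  by exists (b ^+ 2 / a ^+ 2); rewrite mulrC divfK// gt_eqF.
have [v ev] : exists v, B = a ^+ 2 * v.
  by exists (B / a ^+ 2); rewrite mulrC divfK// gt_eqF.
have u0 : 0 <= u by rewrite -(pmulr_rge0 _ a2) -eu sqr_ge0.
have qu : 20 * q * u < 1.
  by move: ab; rewrite eu; rewrite mulrCA -[ltRHS]mulr1 ltr_pM2l.
have v2 : v ^+ 2 <= 4 * u.
  have : B ^+ 2 <= (2 * a * b) ^+ 2.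
    suff : 0 <= (2 * a * b - B) * (2 * a * b + B) by lra.
    by rewrite mulr_ge0//; lra.
  rewrite ev !exprMn eu => h.
  by rewrite -(ler_pM2l (mulr_gt0 a2 a2)); lra.
rewrite ev eu in P1 P2 P3 *.
have F (c : R) : 0 <= a ^+ 2 * c -> (a ^+ 2 * c) `^ q = (a ^+ 2) `^ q * c `^ q.
  by rewrite pmulr_rge0// => c0; rewrite powRM// ltW.
have E c : 0 <= a ^+ 2 * (1 + c) -> (a ^+ 2 * (1 + c)) `^ q <= (a ^+ 2) `^ q * expR (c * q).
  move=> c0; rewrite F// ler_wpM2l ?powR_ge0// expRM ge0_ler_powR ?nnegrE ?expR_ge0//.
    by rewrite -(pmulr_rge0 _ a2).
  exact: expR_ge1Dx.
have e1 : a ^+ 2 + a ^+ 2 * u + a ^+ 2 * v = a ^+ 2 * (1 + (u + v)) by ring.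
have e2 : a ^+ 2 + a ^+ 2 * u - a ^+ 2 * v = a ^+ 2 * (1 + (u - v)) by ring.
have e3 : a ^+ 2 + 22 * q * (a ^+ 2 * u) = a ^+ 2 * (1 + 22 * q * u) by ring.
rewrite e1 in P1 *; rewrite e2 in P2 *; rewrite e3 in P3 *.
apply: (@le_trans _ _ ((a ^+ 2) `^ q * (expR (u * q) * ((expR (v * q) + expR (- (v * q))) / 2)))).
  have := E _ P1; have := E _ P2.
  rewrite !mulrDl expRD mulNr expRD.
  by lra.
rewrite F// ler_wpM2l ?powR_ge0//.
apply: (@le_trans _ _ (expR ((u * (1 + 8 * q)) * q))).
  apply: (@le_trans _ _ (expR (u * q) * expR (2 * (v * q) ^+ 2))).
    by rewrite ler_wpM2l ?expR_ge0// cosh_le_gauss.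
  rewrite -expRD ler_expR exprMn.
  suff : v ^+ 2 * q ^+ 2 <= 4 * u * q ^+ 2 by lra.
  by rewrite ler_wpM2r ?sqr_ge0.
rewrite expRM ge0_ler_powR ?nnegrE ?expR_ge0//.
  by rewrite -(pmulr_rge0 _ a2).
have qu0 : 0 <= q * u by rewrite mulr_ge0.
have uq : u <= q * u by rewrite ler_peMl.
(* [expR t <= 1 + 22 q u] since [t <= 9 q u] is bounded away from one. *)
pose t := u * (1 + 8 * q).
have t9 : t <= 9 * (q * u) by rewrite /t; lra.
have t0 : 0 <= t by rewrite mulr_ge0//; lra.
have t1 : t < 1 by lra.
rewrite -/t; apply: (le_trans (expR_le_invB1 t1)).
rewrite -[leLHS]mul1r ler_pdivrMr; last by lra.
suff : 0 <= (9 * (q * u) - t) * (1 + 22 * (q * u)) + q * u * (13 - 198 * (q * u)).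
  by lra.
by rewrite addr_ge0// mulr_ge0//; lra.
Qed.

(** The Hilbert space structure of the plane reduces complex increments to
    real ones: only the real part of the inner product changes sign. *)
Lemma two_point p (X Y : R[i]) : 2 <= p ->
  (nm (X + Y) `^ p + nm (X - Y) `^ p) / 2 <=
  (nm X ^+ 2 + 11 * p * nm Y ^+ 2) `^ (p / 2).
Proof.
move=> p2.
have E (z : R[i]) : nm z `^ p = (nm z ^+ 2) `^ (p / 2).
  by rewrite -powR_mulrn ?nm_ge0// -powRrM mulrC divfK.
pose B := 2 * (complex.Re X * complex.Re Y + complex.Im X * complex.Im Y).
have hB : `|B| <= 2 * nm X * nm Y.
  rewrite /B normrM (ger0_norm (_ : 0 <= 2))// -mulrA ler_pM2l//.
  rewrite -(@ler_pXn2r _ 2)// ?nnegrE ?mulr_ge0 ?nm_ge0//.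
  rewrite exprMn !nm_sqr real_normK ?num_real//.
  have := sqr_ge0 (complex.Re X * complex.Im Y - complex.Im X * complex.Re Y).
  by lra.
rewrite !E.
have -> : nm (X + Y) ^+ 2 = nm X ^+ 2 + nm Y ^+ 2 + B.
  by rewrite !nm_sqr raddfD/= raddfD/= /B; ring.
have -> : nm (X - Y) ^+ 2 = nm X ^+ 2 + nm Y ^+ 2 - B.
  by rewrite !nm_sqr raddfB/= raddfB/= /B; ring.
have -> : 11 * p = 22 * (p / 2) by lra.
by apply: two_point_real; rewrite ?nm_ge0//; lra.
Qed.
End two_point.

(** * Dyadic martingales on a finite set *)

Section weighted_norm.
Variables (R : realType) (J : finType) (c : R).
Hypothesis c_ge0 : 0 <= c.
Implicit Types (q p : R) (h g : J -> R).

Definition wnorm q h : R := (c * \sum_x h x `^ q) `^ q^-1.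

Lemma wsum_ge0 q h : 0 <= c * \sum_x h x `^ q.
Proof. by rewrite mulr_ge0// sumr_ge0// => x _; exact: powR_ge0. Qed.

Lemma wnorm_ge0 q h : 0 <= wnorm q h.
Proof. exact: powR_ge0. Qed.

Lemma wnorm_powR q h : q != 0 -> wnorm q h `^ q = c * \sum_x h x `^ q.
Proof. by move=> q0; rewrite -powRrM mulVf// powRr1// wsum_ge0. Qed.

Lemma le_wnorm q h g : 0 <= q -> (forall x, 0 <= h x) -> (forall x, h x <= g x) ->
  wnorm q h <= wnorm q g.
Proof.
move=> q0 h0 hg; rewrite ge0_ler_powR ?invr_ge0 ?nnegrE ?wsum_ge0//.
rewrite ler_wpM2l// ler_sum// => x _; rewrite ge0_ler_powR ?nnegrE//.
exact: le_trans (h0 x) (hg x).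
Qed.

Lemma wnormZ q k h : q != 0 -> 0 <= k -> (forall x, 0 <= h x) ->
  wnorm q (fun x => k * h x) = k * wnorm q h.
Proof.
move=> q0 k0 h0; rewrite /wnorm.
have -> : c * \sum_x (k * h x) `^ q = k `^ q * (c * \sum_x h x `^ q).
  rewrite mulrCA; congr (c * _); rewrite mulr_sumr.
  by apply: eq_bigr => x _; rewrite powRM.
by rewrite powRM ?powR_ge0 ?wsum_ge0// -powRrM mulfV// powRr1.
Qed.

(** Rescaling both functions to unit norm turns the triangle inequality into
    convexity of the power function. *)
Lemma wnormD q h g : 1 <= q -> (forall x, 0 <= h x) -> (forall x, 0 <= g x) ->
  wnorm q (fun x => h x + g x) <= wnorm q h + wnorm q g.
Proof.
move=> q1 h0 g0; have q_gt0 : 0 < q by lra.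
have q0 : q != 0 by rewrite gt_eqF.
have [c0|cn0] := eqVneq c 0.
  by rewrite /wnorm c0 !mul0r powR0 ?invr_eq0// addr0.
have zero (k : J -> R) : wnorm q k = 0 -> forall x, k x = 0.
  move=> /powR_eq0_eq0/eqP; rewrite mulf_eq0 (negbTE cn0)/=.
  rewrite psumr_eq0; last by move=> ? _; exact: powR_ge0.
  by move=> /allP k0 x; apply: (@powR_eq0_eq0 _ _ q); apply/eqP/k0; rewrite mem_index_enum.
have [A0|An0] := eqVneq (wnorm q h) 0.
  rewrite A0 add0r; rewrite le_wnorm ?ltW// => x; first by rewrite addr_ge0.
  by rewrite (zero _ A0) add0r.
have [B0|Bn0] := eqVneq (wnorm q g) 0.
  rewrite B0 addr0; rewrite le_wnorm ?ltW// => x; first by rewrite addr_ge0.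
  by rewrite (zero _ B0) addr0.
move: (wnorm_ge0 q h) (wnorm_ge0 q g) An0 Bn0.
move: (wnorm_powR h q0) (wnorm_powR g q0).
move: (wnorm q h) (wnorm q g) => A B hA hB A_ge0 B_ge0 An0 Bn0.
have A_gt0 : 0 < A by rewrite lt_neqAle eq_sym An0.
have B_gt0 : 0 < B by rewrite lt_neqAle eq_sym Bn0.
have AB : 0 < A + B by rewrite addr_gt0.
suff H : wnorm q (fun x => h x + g x) `^ q <= (A + B) `^ q.
  rewrite leNgt; apply/negP => /(gt0_ltr_powR q_gt0).
  rewrite !nnegrE wnorm_ge0 (ltW AB) => /(_ isT isT).
  by rewrite ltNge H.
rewrite wnorm_powR//.
have tb : 0 <= A / (A + B) <= 1.
  apply/andP; split; first by rewrite divr_ge0// ltW.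
  by rewrite ler_pdivrMr// mul1r lerDl ltW.
have pt x : (h x + g x) `^ q <= (A + B) `^ q *
    (A / (A + B) * (h x `^ q / A `^ q) + B / (A + B) * (g x `^ q / B `^ q)).
  have hxA : 0 <= h x / A by rewrite divr_ge0// ltW.
  have gB : 0 <= g x / B by rewrite divr_ge0// ltW.
  have e : h x + g x = (A + B) * (A / (A + B) * (h x / A) + B / (A + B) * (g x / B)).
    by field; rewrite An0 Bn0 gt_eqF.
  have e1 : B / (A + B) = 1 - A / (A + B) by field; rewrite gt_eqF.
  have s1 : 0 <= B / (A + B) by rewrite divr_ge0// ltW.
  have s0 : 0 <= A / (A + B) by rewrite divr_ge0// ltW.
  rewrite e powRM; last 2 first.
  - exact: ltW.
  - by rewrite addr_ge0// mulr_ge0.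
  rewrite ler_wpM2l ?powR_ge0//.
  have powRd (y z : R) : 0 <= y -> 0 < z -> (y / z) `^ q = y `^ q / z `^ q.
    move=> y0 z0; have z_ge0 := ltW z0.
    have yz : 0 <= y / z by rewrite divr_ge0.
    apply: (@mulIf _ (z `^ q)); first by rewrite gt_eqF// powR_gt0.
    by rewrite -powRM// !divfK ?gt_eqF// powR_gt0.
  rewrite -!powRd//.
  have nn (y : R) : 0 <= y -> y \in (`[0, +oo[%classic : set R).
    by move=> y0; rewrite inE/= in_itv/= andbT.
  have := @convex_powR R q q1 (Itv01 (proj1 (andP tb)) (proj2 (andP tb)))
    _ _ (nn _ hxA) (nn _ gB).
  by rewrite !convRE/= e1.
apply: (@le_trans _ _ (c * \sum_x ((A + B) `^ q *
    (A / (A + B) * (h x `^ q / A `^ q) + B / (A + B) * (g x `^ q / B `^ q))))).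
  by rewrite ler_wpM2l// ler_sum.
have Aq : A `^ q != 0 by rewrite gt_eqF// powR_gt0.
have Bq : B `^ q != 0 by rewrite gt_eqF// powR_gt0.
rewrite -mulr_sumr big_split/= -!mulr_sumr -!mulr_suml.
rewrite le_eqVlt; apply/orP; left; apply/eqP.
have -> : \sum_x h x `^ q = A `^ q / c by rewrite hA mulrC mulKf.
have -> : \sum_x g x `^ q = B `^ q / c by rewrite hB mulrC mulKf.
by field; rewrite Aq Bq cn0 gt_eqF.
Qed.

(** One step of a dyadic martingale. The involution [sigma] exchanges the two
    halves of each dyadic block, so that averaging over its orbits turns the
    increment into a symmetric one, and the two-point inequality applies. *)
Lemma wnorm_involution p (sigma : J -> J) (F : J -> R[i]) : 2 <= p ->
  involutive sigma ->
  wnorm (p / 2) (fun x => nm (F x) ^+ 2) <=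
  wnorm (p / 2) (fun x => nm ((F x + F (sigma x)) / 2) ^+ 2) +
  11 * p * wnorm (p / 2) (fun x => nm ((F x - F (sigma x)) / 2) ^+ 2).
Proof.
move=> p2 sigmaK; have q1 : 1 <= p / 2 by lra.
have q0 : p / 2 != 0 by rewrite gt_eqF//; lra.
have q_ge0 : 0 <= p / 2 by lra.
set M := fun x => nm ((F x + F (sigma x)) / 2) ^+ 2.
set D := fun x => nm ((F x - F (sigma x)) / 2) ^+ 2.
have p0 : 0 <= 11 * p by lra.
have D0 x : 0 <= D x by exact: sqr_ge0.
have -> : 11 * p * wnorm (p / 2) D = wnorm (p / 2) (fun x => 11 * p * D x).
  by rewrite wnormZ.
apply: le_trans (wnormD q1 _ _); last 2 first.
- by move=> x; exact: sqr_ge0.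
- by move=> x; rewrite mulr_ge0.
rewrite ge0_ler_powR ?invr_ge0 ?nnegrE ?wsum_ge0// ler_wpM2l//.
have -> : \sum_x (nm (F x) ^+ 2) `^ (p / 2) =
    \sum_x (nm (F x) `^ p + nm (F (sigma x)) `^ p) / 2.
  have e x : (nm (F x) ^+ 2) `^ (p / 2) = nm (F x) `^ p.
    by rewrite -powR_mulrn ?nm_ge0// -powRrM mulrC divfK.
  under eq_bigr do rewrite e.
  have e2 : \sum_x nm (F (sigma x)) `^ p = \sum_x nm (F x) `^ p.
    by rewrite [RHS](reindex_inj (inv_inj sigmaK)).
  by rewrite -mulr_suml big_split/= e2; lra.
apply: ler_sum => x _; apply: le_trans (two_point _ _ p2).
have h2 : (2 : R[i]) != 0 by rewrite pnatr_eq0.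
have -> : (F x + F (sigma x)) / 2 + (F x - F (sigma x)) / 2 = F x by field.
by have -> : (F x + F (sigma x)) / 2 - (F x - F (sigma x)) / 2 = F (sigma x) by field.
Qed.

(** [A s] are the conditional expectations, from the function itself ([A 0]) to
    the coarsest average ([A N]). The coarser average enters
    [wnorm_involution] with coefficient one, so telescoping preserves the
    factor [p]. *)
Lemma wnorm_martingale p (N : nat) (sigma : nat -> J -> J)
    (A : nat -> J -> R[i]) : 2 <= p ->
  (forall s, (s < N)%N -> involutive (sigma s)) ->
  (forall s x, (s < N)%N -> A s.+1 x = (A s x + A s (sigma s x)) / 2) ->
  wnorm (p / 2) (fun x => nm (A 0 x) ^+ 2) <=
  wnorm (p / 2) (fun x => nm (A N x) ^+ 2) +
  11 * p * \sum_(s < N) wnorm (p / 2) (fun x => nm ((A s x - A s (sigma s x)) / 2) ^+ 2).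
Proof.
move=> p2; elim: N => [|N IH] sigmaK AS; first by rewrite big_ord0 mulr0 addr0.
have := IH (fun s sN => sigmaK s (ltnW sN)) (fun s x sN => AS s x (ltnW sN)).
have := wnorm_involution (A N) p2 (sigmaK N (ltnSn N)).
have -> : (fun x => nm ((A N x + A N (sigma N x)) / 2) ^+ 2) =
    (fun x => nm (A N.+1 x) ^+ 2) by apply/funext => x; rewrite AS.
rewrite big_ord_recr/=; set d := wnorm _ (fun x => nm (_ / 2) ^+ 2).
rewrite mulrDr => h1 h2; apply: (le_trans h2); 
by apply: le_trans (lerD h1 (lexx _)) _; rewrite addrAC addrA.
Qed.
End weighted_norm.

(** * Arcs and chords of the unit circle *)

Section expi_facts.
Variable R : realType.
Implicit Types t u : R.
Local Notation expi := (@expi R).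

Lemma expiD t u : expi (t + u) = expi t * expi u.
Proof. by rewrite /expi cosD sinD; simpc; congr (_ +i* _)%C; rewrite addrC. Qed.

Lemma expi0 : expi 0 = 1.
Proof. by rewrite /expi cos0 sin0. Qed.

Lemma nm_expi t : nm (expi t) = 1.
Proof. by rewrite /= cos2Dsin2 sqrtr1. Qed.

Lemma expiN t : expi (- t) = ((expi t)^*)%C.
Proof. by rewrite /expi cosN sinN. Qed.

Lemma expi_mulrn t (n : nat) : expi (t *+ n) = expi t ^+ n.
Proof. by elim: n => [|n IH]; rewrite ?mulr0n ?expi0// mulrS expiD IH exprS. Qed.

Lemma expi_2pi (k : int) : expi (2 * pi * k%:~R) = 1.
Proof.
have E : expi (2 * pi) = 1 by rewrite /expi mulr_natl cos2pi sin2pi.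
have En (n : nat) : expi (2 * pi * n%:R) = 1 by rewrite mulr_natr expi_mulrn E expr1n.
by case: k => n; rewrite ?NegzE ?mulrNz ?mulrN ?expiN -pmulrn En ?conjc1.
Qed.

Lemma nm_expiB1 t : nm (expi t - 1) ^+ 2 = 2 - 2 * cos t.
Proof.
rewrite nm_sqr/= subr0; have := cos2Dsin2 t.
by move: (cos t) (sin t) => x y ?; lra.
Qed.

Lemma sin_le_id t : 0 <= t -> sin t <= t.
Proof.
move=> t0.
have dsin (x : R) : x \in `]0, t[%R -> is_derive x 1 sin (cos x).
  by move=> _; exact: is_derive_sin.
have csin : {within `[0, t], continuous (@sin R)}.
  by apply: continuous_subspaceT => x; exact: continuous_sin.
have [c _] := MVT_segment t0 dsin csin.
by rewrite sin0 !subr0 => ->; rewrite ler_piMl// cos_le1.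
Qed.

Lemma nm_expiB1_le t : nm (expi t - 1) <= `|t|.
Proof.
wlog t0 : t / 0 <= t.
  move=> H; have [t0|t0] := leP 0 t; first exact: H.
  by have := H (- t); rewrite normrN expiN -[X in _ - X]conjc1 -rmorphB nmJ; apply; lra.
rewrite ger0_norm// -(@ler_pXn2r _ 2)// ?nnegrE ?nm_ge0// nm_expiB1.
have [t4|t4] := leP t 2; last first.
  have : cos t >= -1 by rewrite cos_geN1.
  by nra.
have -> : t = (t / 2) *+ 2 by rewrite -mulr_natr divfK.
rewrite cos_mulr2n.
have s0 : 0 <= sin (t / 2).
  by apply: sin_ge0_pi; have := pi_ge2 R; lra.
have s1 : sin (t / 2) <= t / 2 by rewrite sin_le_id//; lra.
have := cos2Dsin2 (t / 2); move: (sin _) (cos _) s0 s1 => x y x0 xt e.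
have : x ^+ 2 <= (t / 2) ^+ 2 by rewrite lerXn2r ?nnegrE//; lra.
lra.
Qed.

Lemma nm_expi_Lip t u : nm (expi t - expi u) <= `|t - u|.
Proof.
have -> : expi t - expi u = expi u * (expi (t - u) - 1).
  by rewrite mulrBr -expiD mulr1 (addrC u) subrK.
by rewrite nmM nm_expi mul1r nm_expiB1_le.
Qed.

(** Arcs of at least a quarter turn are clear; doubling a shorter arc at most
    doubles its chord. *)
Lemma nm_expi_chord t : 0 <= t <= 2^-1 -> 2 * t <= nm (expi (2 * pi * t) - 1).
Proof.
move=> /andP[t0]; rewrite le_eqVlt in t0; case/orP : t0 => [/eqP<-|t0] th.
  by rewrite mulr0 nm_ge0.
have base (u : R) : 1 <= 4 * u -> u <= 2^-1 ->
    2 * u <= nm (expi (2 * pi * u) - 1).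
  move=> u4 u2.
  rewrite -(@ler_pXn2r _ 2)// ?nnegrE ?nm_ge0//; last by lra.
  rewrite nm_expiB1.
  have : 0 <= cos (pi - 2 * pi * u).
    apply: cos_ge0_pihalf; have := pi_gt0 R.
    by move: (pi : R) => P P0; nra.
  rewrite addrC cosDpi cosN; move: (cos _) => c c0.
  by nra.
suff H (n : nat) (u : R) : 1 <= 2 ^+ n * 4 * u -> u <= 2^-1 ->
    2 * u <= nm (expi (2 * pi * u) - 1).
  pose n := Num.trunc (t^-1); apply: (H n.+1) => //.
  have : t^-1 < n.+1%:R by exact: truncnS_gt.
  have : n.+1%:R <= 2 ^+ n.+1 :> R by rewrite -natrX ler_nat ltnW// ltn_expl.
  move=> h1 h2; have : t^-1 * t <= 2 ^+ n.+1 * t by rewrite ler_pM2r//; lra.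
  by rewrite mulVf ?gt_eqF//; lra.
elim: n u => [|n IH] u; first by rewrite expr0 mul1r => *; exact: base.
move=> hu u2; have [u4|u4] := leP u 4^-1; last by apply: base => //; lra.
have := IH (2 * u); rewrite exprS in hu.
move=> /(_ ltac:(lra) ltac:(lra)).
have -> : 2 * pi * (2 * u) = 2 * pi * u + 2 * pi * u by ring.
have -> : expi (2 * pi * u + 2 * pi * u) - 1 =
    (expi (2 * pi * u) - 1) * (expi (2 * pi * u) + 1) by rewrite expiD; ring.
rewrite nmM => h.
have h2 : nm (expi (2 * pi * u) + 1) <= 2.
  by rewrite (le_trans (nmD _ _))// nm_expi (nm_nat R 1).
have := nm_ge0 (expi (2 * pi * u) - 1).
by move: (nm _) (nm _) h h2 => x y; nra.
Qed.
End expi_facts.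

(** * Characters of a cyclic group and Parseval's identity *)

Section cyclic_characters.
Variables (R : realType) (M : nat).
Hypothesis M_gt0 : (0 < M)%N.
Implicit Types (r k : int) (B : R).
Local Notation C := R[i].

Definition cchar k : C := expi (2 * pi * (k%:~R / M%:R)).

Let MR_gt0 : 0 < M%:R :> R. Proof. by rewrite ltr0n. Qed.
Let MR_neq0 : M%:R != 0 :> R. Proof. by rewrite gt_eqF. Qed.

Lemma ccharD r k : cchar (r + k) = cchar r * cchar k.
Proof. by rewrite /cchar -expiD -mulrDr -mulrDl intrD. Qed.

Lemma cchar0 : cchar 0 = 1.
Proof. by rewrite /cchar mul0r mulr0 expi0. Qed.

Lemma ccharN k : cchar (- k) = ((cchar k)^*)%C.
Proof. by rewrite /cchar mulrNz mulNr mulrN expiN. Qed.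

Lemma nm_cchar k : nm (cchar k) = 1.
Proof. exact: nm_expi. Qed.

Lemma ccharM k (j : nat) : cchar (k * j%:Z) = cchar k ^+ j.
Proof. by rewrite /cchar -expi_mulrn -mulr_natr intrM -!pmulrn; congr expi; ring. Qed.

Lemma cchar_period k : cchar (k * M%:Z) = 1.
Proof. by rewrite /cchar intrM -pmulrn mulfK// expi_2pi. Qed.

Lemma cchar_chord (j : nat) : (j <= M)%N ->
  2 * (minn j (M - j))%:R / M%:R <= nm (cchar j%:Z - 1).
Proof.
move=> jM.
have half (i : nat) : (i.*2 <= M)%N -> 2 * i%:R / M%:R <= nm (cchar i%:Z - 1).
  move=> iM; rewrite -mulrA; apply: nm_expi_chord.
  rewrite divr_ge0//= ler_pdivrMr//.
  have : (i.*2)%:R <= M%:R :> R by rewrite ler_nat.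
  by rewrite -muln2 natrM; lra.
have [h|h] := leqP (j.*2) M.
  by rewrite (minn_idPl _); [exact: half|lia].
rewrite (minn_idPr _); last by lia.
apply: (le_trans (half (M - j)%N _)); first by lia.
have -> : (M - j)%N%:Z = - (j%:Z) + 1 * M%:Z by lia.
rewrite ccharD cchar_period mulr1 ccharN.
by rewrite -[X in _ - X]conjc1 -rmorphB nmJ.
Qed.

Lemma sum_cchar0 k : (0 < `|k| < M)%N -> \sum_(j < M) cchar (k * j%:Z) = 0.
Proof.
move=> /andP[k0 kM].
have ne1 (j : nat) : (0 < j < M)%N -> cchar j%:Z != 1.
  move=> /andP[j0 jM]; apply/eqP => E; have := cchar_chord (ltnW jM).
  rewrite E subrr nm0 leNgt => /negP; apply.
  by rewrite divr_gt0// mulr_gt0// ltr0n; lia.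
have kne : cchar k != 1.
  have [kp|kn] := leP 0 k.
    by rewrite -(gez0_abs kp) ne1// k0 kM.
  have -> : k = - (`|k|%N%:Z) by rewrite ltz0_abs// opprK.
  rewrite ccharN; apply/eqP => /(congr1 conjc); rewrite conjcK conjc1; apply/eqP.
  by rewrite ne1// k0 kM.
under eq_bigr do rewrite ccharM.
apply: (@mulfI _ (cchar k - 1)); first by rewrite subr_eq0.
by rewrite -subrX1 -ccharM cchar_period subrr mulr0.
Qed.

Definition dft (n : nat) (a : nat -> C) (j : nat) : C :=
  \sum_(s < n) a s * cchar (s%:Z * j%:Z).

Lemma sum_dft n m a b r :
  \sum_(j < M) dft n a j * ((dft m b j)^*)%C * cchar (r * j%:Z) =
  \sum_(s < n) \sum_(t < m) a s * ((b t)^*)%C *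
     \sum_(j < M) cchar ((s%:Z - t%:Z + r) * j%:Z).
Proof.
under [RHS]eq_bigr => s _ do under eq_bigr => t _ do rewrite mulr_sumr.
under [RHS]eq_bigr => s _ do rewrite exchange_big/=.
rewrite [RHS]exchange_big/=; apply: eq_bigr => j _.
rewrite /dft rmorph_sum !mulr_suml; apply: eq_bigr => s _.
rewrite mulr_sumr mulr_suml; apply: eq_bigr => t _.
rewrite mulrDl mulrBl !ccharD ccharN rmorphM/=; ring.
Qed.

Lemma nm_sqrC (z : C) : ((nm z ^+ 2)%:C)%C = z * (z^*)%C.
Proof. by rewrite -sqr_normc rmorphXn. Qed.

Lemma parseval n a : (n <= M)%N ->
  \sum_(j < M) nm (dft n a j) ^+ 2 = M%:R * \sum_(s < n) nm (a s) ^+ 2.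
Proof.
move=> nM; apply: (@complexI R); rewrite rmorphM !rmorph_sum/=.
have -> : \sum_(j < M) ((nm (dft n a j) ^+ 2)%:C)%C =
    \sum_(j < M) dft n a j * ((dft n a j)^*)%C * cchar (0 * j%:Z).
  by apply: eq_bigr => j _; rewrite mul0r cchar0 mulr1 nm_sqrC.
rewrite sum_dft mulr_sumr; apply: eq_bigr => s _.
rewrite (bigD1 s)//= [X in _ + X]big1 ?addr0; last first.
  move=> t ts; rewrite sum_cchar0 ?mulr0//.
  have : s != t :> nat by rewrite eq_sym.
  by have := ltn_ord s; have := ltn_ord t; lia.
rewrite ?addr0; under eq_bigr do rewrite subrr mul0r cchar0.
by rewrite sumr_const card_ord nm_sqrC rmorph_nat mulrC.
Qed.
End cyclic_characters.

(** * A discrete Bernstein inequality *)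

Section kernels.
Variables (R : realType) (M : nat).
Hypothesis M_gt0 : (0 < M)%N.
Implicit Types (r k : int) (B : R).
Local Notation C := R[i].
Local Notation ch := (cchar R M).

Let MR_gt0 : 0 < M%:R :> R. Proof. by rewrite ltr0n. Qed.
Let MR_neq0 : M%:R != 0 :> R. Proof. by rewrite gt_eqF. Qed.
Let MC_neq0 : M%:R != 0 :> C. Proof. by rewrite pnatr_eq0 -lt0n. Qed.

(** A list of frequencies with coefficients, possibly with repetitions, makes
    this class closed under linear combinations in an obvious way. *)
Definition band (lo hi : nat) (phi : nat -> C) : Prop :=
  exists S : seq (int * C), {in S, forall p, (lo <= `|p.1| <= hi)%N} /\
    forall y : nat, phi y = \sum_(p <- S) p.2 * ch (p.1 * y%:Z).

Lemma kernel_multiplier (S : seq (int * C)) (mu : int -> C) (phi K : nat -> C) (y : nat) :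
  (forall y : nat, phi y = \sum_(p <- S) p.2 * ch (p.1 * y%:Z)) ->
  {in S, forall p, \sum_(j < M) K j * ch (p.1 * j%:Z) = mu p.1} ->
  \sum_(j < M) K j * phi (y + j)%N = \sum_(p <- S) mu p.1 * p.2 * ch (p.1 * y%:Z).
Proof.
move=> hphi hK; under eq_bigr do rewrite hphi mulr_sumr.
rewrite exchange_big/= big_seq [RHS]big_seq; apply: eq_bigr => r rS.
rewrite -hK// !mulr_suml; apply: eq_bigr => j _.
by rewrite PoszD mulrDr ccharD; ring.
Qed.

Lemma kernel_bound (phi K : nat -> C) B (y : nat) : (forall y, nm (phi y) <= B) ->
  nm (\sum_(j < M) K j * phi (y + j)%N) <= (\sum_(j < M) nm (K j)) * B.
Proof.
move=> hB; rewrite (le_trans (nm_sum _ _ _))// mulr_suml ler_sum// => j _.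
by rewrite nmM ler_wpM2l// nm_ge0.
Qed.

Definition dft_kernel n m a b (j : nat) : C :=
  M%:R^-1 * (dft M n a j * ((dft M m b j)^*)%C).

(** The Cauchy-Schwarz inequality with Parseval's identity; the weight [lam]
    stands for the quotient of the two norms. *)
Lemma dft_kernel_bound n m a b (lam : R) : (n <= M)%N -> (m <= M)%N -> 0 < lam ->
  \sum_(j < M) nm (dft_kernel n m a b j) <=
  (lam * \sum_(s < n) nm (a s) ^+ 2 + lam^-1 * \sum_(t < m) nm (b t) ^+ 2) / 2.
Proof.
move=> nM mM lam0.
have l0 : lam != 0 by rewrite gt_eqF.
have pt j : nm (dft_kernel n m a b j) <=
    M%:R^-1 * ((lam * nm (dft M n a j) ^+ 2 + lam^-1 * nm (dft M m b j) ^+ 2) / 2).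
  rewrite /dft_kernel !nmM nmJ nmV nm_nat ler_wpM2l ?invr_ge0//.
  move: (nm (dft M n a j)) (nm (dft M m b j)) => x y.
  have -> : (lam * x ^+ 2 + lam^-1 * y ^+ 2) / 2 =
      x * y + lam^-1 * (lam * x - y) ^+ 2 / 2 by field.
  by rewrite lerDl divr_ge0// mulr_ge0 ?sqr_ge0// invr_ge0 ltW.
apply: (@le_trans _ _ (\sum_(j < M)
    M%:R^-1 * ((lam * nm (dft M n a j) ^+ 2 + lam^-1 * nm (dft M m b j) ^+ 2) / 2))).
  by apply: ler_sum => j _; exact: pt.
rewrite -mulr_sumr -mulr_suml big_split/= -!mulr_sumr !parseval//.
by rewrite le_eqVlt; apply/orP; left; apply/eqP; field; rewrite MR_neq0 l0.
Qed.

Lemma cchar_Lip (s : nat) : nm (ch s%:Z - 1) <= s%:R * (8 / M%:R).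
Proof.
rewrite (le_trans (nm_expiB1_le _))// -pmulrn ger0_norm; last first.
  by rewrite mulr_ge0 ?divr_ge0// mulr_ge0// pi_ge0.
have p4 : pi <= 4 :> R by have := pihalf_02 R; lra.
have -> : 2 * pi * (s%:R / M%:R) = s%:R * (2 * pi / M%:R) :> R by ring.
by rewrite ler_wpM2l// ler_wpM2r ?invr_ge0//; lra.
Qed.

Lemma dft_kernel_multiplier (L : nat) a b r : (3 * L <= M)%N -> (0 < L)%N ->
  (`|r| <= L)%N -> (forall t, (t < L)%N -> b t = 0) ->
  \sum_(j < M) dft_kernel (3 * L) (2 * L) a b j * ch (r * j%:Z) =
  \sum_(t < 2 * L | (L <= t)%N) a `|t%:Z - r|%N * ((b t)^*)%C.
Proof.
move=> LM L0 rL b0.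
under eq_bigr do rewrite -mulrA.
rewrite -mulr_sumr sum_dft exchange_big/= mulr_sumr [RHS]big_mkcond/=.
apply: eq_bigr => t _; case: ifPn => [Lt|]; last first.
  rewrite -ltnNge => tL; rewrite big1 ?mulr0// => s _.
  by rewrite b0// conjc0 mulr0 mul0r.
have sP : (`|t%:Z - r| < 3 * L)%N by have := ltn_ord t; lia.
rewrite (bigD1 (Ordinal sP))//= [X in _ + X]big1 ?addr0; last first.
  move=> s sne; rewrite sum_cchar0 ?mulr0//.
  have : (s : nat) != `|t%:Z - r|%N by [].
  by have := ltn_ord s; have := ltn_ord t; lia.
have -> : (`|t%:Z - r|%N%:Z - t%:Z + r) = 0 by have := ltn_ord t; lia.
under eq_bigr do rewrite mul0r cchar0.
by rewrite sumr_const card_ord mulrCA mulVf// mulr1.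
Qed.

(** On the band the multiplier [ch r - 1] is represented by kernels of de la
    Vallee Poussin type: products of two transforms, whose mass is controlled by
    [dft_kernel_bound]. *)
Lemma bernstein (L : nat) (phi : nat -> C) B (y : nat) :
  (3 * L <= M)%N -> (0 < L)%N -> band 0 L phi -> (forall y, nm (phi y) <= B) ->
  nm (phi y.+1 - phi y) <= 140 * L%:R / M%:R * B.
Proof.
move=> LM L0 [S [hS hphi]] hB.
(* [ch r - 1 = (ch (r - t) - 1) * ch t + (ch t - 1)], averaged over
   [L <= t < 2 * L]. In each product one factor depends on [t - r], which stays
   in [0, 3 * L) for [|r| <= L], and the other one on [t]. *)
pose a1 (s : nat) : C := ch (- s%:Z) - 1.
pose b1 (t : nat) : C := if (L <= t)%N then L%:R^-1 * ch (- t%:Z) else 0.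
pose a2 (s : nat) : C := 1.
pose b2 (t : nat) : C := if (L <= t)%N then L%:R^-1 * (ch (- t%:Z) - 1) else 0.
pose K j := dft_kernel (3 * L) (2 * L) a1 b1 j + dft_kernel (3 * L) (2 * L) a2 b2 j.
have L2M : (2 * L <= M)%N by lia.
have LR0 : 0 < L%:R :> R by rewrite ltr0n.
have LC0 : L%:R != 0 :> C by rewrite pnatr_eq0 -lt0n.
have cM (x z : C) : ((x * z)^*)%C = (x^*)%C * (z^*)%C by exact: rmorphM.
have cL : (((L%:R : C)^-1)^*)%C = L%:R^-1 by rewrite fmorphV rmorph_nat.
have cj (t : nat) : ((L%:R^-1 * ch (- t%:Z))^*)%C = L%:R^-1 * ch t%:Z.
  by rewrite cM cL -ccharN opprK.
have cj1 (t : nat) : ((L%:R^-1 * (ch (- t%:Z) - 1))^*)%C = L%:R^-1 * (ch t%:Z - 1).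
  rewrite cM cL; congr (_ * _).
  by rewrite ccharN -[X in _ - X]conjc1 -rmorphB conjcK.
have KE : {in S, forall p, \sum_(j < M) K j * ch (p.1 * j%:Z) = ch p.1 - 1}.
  move=> [r z] /hS/= rL.
  rewrite /K; under eq_bigr do rewrite mulrDl.
  rewrite big_split/= !dft_kernel_multiplier//; last 2 first.
  - by move=> t tL; rewrite /b2 leqNgt tL.
  - by move=> t tL; rewrite /b1 leqNgt tL.
  rewrite -big_split/=.
  rewrite (eq_bigr (fun=> L%:R^-1 * (ch r - 1))); last first.
    move=> t Lt; rewrite /b1 /b2 Lt /a1 /a2.
    rewrite mul1r cj cj1.
    have -> : - `|t%:Z - r|%N%:Z = r - t%:Z by have := ltn_ord t; lia.
    have -> : ch r = ch (r - t%:Z) * ch t%:Z by rewrite -ccharD subrK.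
    by ring.
  have := big_geq_mkord (op := +%R) (idx := 0 : C) L (2 * L) predT
    (fun=> L%:R^-1 * (ch r - 1)).
  rewrite sumr_const_nat => <-.
  have -> : (2 * L - L)%N = L by lia.
  by rewrite -mulr_natr; field.
have -> : phi y.+1 - phi y = \sum_(j < M) K j * phi (y + j)%N.
  rewrite (kernel_multiplier (mu := fun r => ch r - 1) y hphi KE) !hphi -sumrB.
  apply: eq_bigr => r _.
  by rewrite -addn1 PoszD mulrDr mulr1 ccharD; ring.
apply: (le_trans (kernel_bound _ _ hB)).
have B0 : 0 <= B by apply: le_trans (hB 0%N); exact: nm_ge0.
rewrite ler_wpM2r//.
pose de : R := 8 / M%:R.
have de0 : 0 < de by rewrite divr_gt0.
have step : \sum_(j < M) nm (K j) <=
    \sum_(j < M) nm (dft_kernel (3 * L) (2 * L) a1 b1 j) +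
    \sum_(j < M) nm (dft_kernel (3 * L) (2 * L) a2 b2 j).
  by rewrite -big_split/= ler_sum// => j _; exact: nmD.
apply: (le_trans step).
have chN (s : nat) : nm (ch (- s%:Z) - 1) <= s%:R * de.
  by rewrite ccharN -[X in _ - X]conjc1 -rmorphB nmJ; exact: cchar_Lip.
have chN2 (s m : nat) : (s <= m)%N -> nm (ch (- s%:Z) - 1) ^+ 2 <= (m%:R * de) ^+ 2.
  move=> sm; rewrite lerXn2r ?nnegrE ?nm_ge0 ?mulr_ge0// ?(ltW de0)//.
  by rewrite (le_trans (chN s))// ler_wpM2r ?(ltW de0)// ler_nat.
have A1 : \sum_(s < 3 * L) nm (a1 s) ^+ 2 <= 27 * L%:R ^+ 3 * de ^+ 2.
  apply: (@le_trans _ _ (\sum_(s < 3 * L) ((3 * L)%:R * de) ^+ 2)).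
    by apply: ler_sum => s _; exact: chN2 (ltnW (ltn_ord s)).
  by rewrite sumr_const card_ord -mulr_natr natrM; lra.
have sumb (b : nat -> C) (x : R) : 0 <= x -> (forall t, (t < L)%N -> b t = 0) ->
    (forall t, (t <= 2 * L)%N -> nm (b t) ^+ 2 <= x) ->
    \sum_(t < 2 * L) nm (b t) ^+ 2 <= L%:R * x.
  move=> x0 bL bx.
  have := big_geq_mkord (op := +%R) (idx := 0 : R) L (2 * L) predT (fun=> x).
  have -> : L%:R * x = x *+ (2 * L - L) by rewrite mulr_natl; congr (_ *+ _); lia.
  rewrite sumr_const_nat => ->; rewrite [leRHS]big_mkcond/=.
  apply: ler_sum => t _; case: ifPn => [_|]; first exact: bx (ltnW (ltn_ord t)).
  by rewrite -ltnNge => /bL ->; rewrite nm0 expr0n.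
have B1 : \sum_(t < 2 * L) nm (b1 t) ^+ 2 <= L%:R * (L%:R ^- 2).
  apply: sumb; first by rewrite invr_ge0 exprn_ge0.
    by move=> t tL; rewrite /b1 leqNgt tL.
  move=> t _; rewrite /b1; case: ifP => _; last by rewrite nm0 expr0n invr_ge0 exprn_ge0.
  by rewrite nmM nm_cchar mulr1 nmV nm_nat exprVn.
have A2 : \sum_(s < 3 * L) nm (a2 s) ^+ 2 = 3 * L%:R.
  under eq_bigr do rewrite /a2 (nm_nat R 1) expr1n.
  by rewrite sumr_const card_ord natrM.
have B2 : \sum_(t < 2 * L) nm (b2 t) ^+ 2 <= L%:R * (4 * de ^+ 2).
  apply: sumb; first by rewrite mulr_ge0 ?sqr_ge0.
    by move=> t tL; rewrite /b2 leqNgt tL.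
  move=> t tL; rewrite /b2; case: ifP => _; last first.
    by rewrite nm0 expr0n mulr_ge0 ?sqr_ge0.
  rewrite nmM nmV nm_nat exprMn; apply: (@le_trans _ _ (L%:R^-1 ^+ 2 * ((2 * L)%:R * de) ^+ 2)).
    by rewrite ler_wpM2l ?sqr_ge0// chN2.
  by rewrite natrM le_eqVlt; apply/orP; left; apply/eqP; field; rewrite gt_eqF.
(* The weights [(L ^+ 2 * de)^-1] and [de] balance the two masses. *)
have l1 : 0 < (L%:R ^+ 2 * de)^-1 by rewrite invr_gt0 mulr_gt0// exprn_gt0.
have E1 : \sum_(j < M) nm (dft_kernel (3 * L) (2 * L) a1 b1 j) <= 14 * L%:R * de.
  apply: (le_trans (dft_kernel_bound _ _ LM L2M l1)).
  apply: (@le_trans _ _ (((L%:R ^+ 2 * de)^-1 * (27 * L%:R ^+ 3 * de ^+ 2) +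
      (L%:R ^+ 2 * de)^-1^-1 * (L%:R * (L%:R ^- 2))) / 2)).
    by rewrite ler_wpM2r// lerD// ler_wpM2l// ltW// invr_gt0.
  by rewrite le_eqVlt; apply/orP; left; apply/eqP; field; rewrite !gt_eqF.
have E2 : \sum_(j < M) nm (dft_kernel (3 * L) (2 * L) a2 b2 j) <= 7 / 2 * L%:R * de.
  apply: (le_trans (dft_kernel_bound _ _ LM L2M de0)).
  rewrite A2; apply: (@le_trans _ _ ((de * (3 * L%:R) + de^-1 * (L%:R * (4 * de ^+ 2))) / 2)).
    by rewrite ler_wpM2r// lerD2l// ler_wpM2l// ltW// invr_gt0.
  by rewrite le_eqVlt; apply/orP; left; apply/eqP; field; rewrite !gt_eqF.
apply: (le_trans (lerD E1 E2)).
by rewrite /de le_eqVlt; apply/orP; left; apply/eqP; field.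
Qed.
End kernels.

(** * Block sums of functions without low frequencies *)

Section window_sums.
Variable R : realType.
Implicit Types be : R.

Lemma window_gradient be n : \sum_(s < n) (be - 1 - 2 * s%:R) ^+ 2 =
  n%:R * (be - 1) ^+ 2 - 2 * (be - 1) * n%:R * (n%:R - 1) +
  2 * n%:R * (n%:R - 1) * (2 * n%:R - 1) / 3.
Proof.
elim: n => [|n IH]; first by rewrite big_ord0; field.
by rewrite big_ord_recr/= IH -natr1; field.
Qed.

Lemma window_mass be n : \sum_(s < n) (s%:R * (be - s%:R)) ^+ 2 =
  be ^+ 2 * (n%:R * (n%:R - 1) * (2 * n%:R - 1) / 6)
  - 2 * be * (n%:R * (n%:R - 1) / 2) ^+ 2
  + n%:R * (n%:R - 1) * (2 * n%:R - 1) * (3 * n%:R ^+ 2 - 3 * n%:R - 1) / 30.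
Proof.
elim: n => [|n IH]; first by rewrite big_ord0; field.
by rewrite big_ord_recr/= IH -natr1; field.
Qed.
End window_sums.

Section block_sums.
Variables (R : realType) (M : nat).
Hypothesis M_gt0 : (0 < M)%N.
Implicit Types (r k : int) (B : R).
Local Notation C := R[i].
Local Notation ch := (cchar R M).

Let MR_gt0 : 0 < M%:R :> R. Proof. by rewrite ltr0n. Qed.

Definition bsum (q : nat) (phi : nat -> C) (x : nat) : C :=
  \sum_(m < q) phi (x + m)%N.

Lemma bsum_shift q phi B (x j : nat) : (forall y, nm (phi y) <= B) ->
  nm (bsum q phi x - bsum q phi (x + j)%N) <= 2 * j%:R * B.
Proof.
move=> hB.
have one y : nm (bsum q phi y - bsum q phi y.+1) <= 2 * B.
  have -> : bsum q phi y - bsum q phi y.+1 = phi y - phi (y + q)%N.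
    rewrite /bsum; case: q => [|q]; first by rewrite !big_ord0 addn0 !subrr.
    rewrite big_ord_recl [X in _ - X]big_ord_recr/= addn0 addSnnS.
    have -> : \sum_(i < q) phi (y + bump 0 i)%N = \sum_(i < q) phi (y.+1 + i)%N.
      by apply: eq_bigr => i _; congr phi; rewrite /bump/=; lia.
    by rewrite opprD addrA addrK.
  by rewrite (le_trans (nmB _ _))//; have := hB y; have := hB (y + q)%N; lra.
elim: j => [|j IH]; first by rewrite addn0 subrr nm0; lra.
have -> : bsum q phi x - bsum q phi (x + j.+1)%N =
   (bsum q phi x - bsum q phi (x + j)%N) +
   (bsum q phi (x + j)%N - bsum q phi (x + j).+1) by rewrite addnS; ring.
rewrite (le_trans (nmD _ _))//; have := one (x + j)%N.
by rewrite -natr1; lra.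
Qed.

Lemma band_period lo hi phi y : band M lo hi phi -> phi (y + M)%N = phi y :> C.
Proof.
move=> [S [_ hphi]]; rewrite !hphi; apply: eq_bigr => r _.
by rewrite PoszD mulrDr ccharD cchar_period// mulr1.
Qed.

Lemma bsum_cyclic_shift lo hi q phi B (x j : nat) : band M lo hi phi ->
  (forall y, nm (phi y) <= B) -> (j <= M)%N ->
  nm (bsum q phi x - bsum q phi (x + j)%N) <= 2 * (minn j (M - j))%:R * B.
Proof.
move=> bphi hB jM; rewrite /minn; case: ifP => _; first exact: bsum_shift.
have -> : bsum q phi x = bsum q phi ((x + j) + (M - j))%N.
  apply: eq_bigr => m _; rewrite -(band_period _ bphi); congr phi; lia.
by rewrite -nmN opprB; exact: bsum_shift.
Qed.

Section window.
Variable b : nat.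
Hypothesis b_gt0 : (0 < b)%N.
Hypothesis bM : (b + 2 <= M)%N.

Let be : R := b.+1%:R.
Let w (s : nat) : C := ((s%:R * (be - s%:R))%:C)%C.
Let W : R := \sum_(s < b.+1) (s%:R * (be - s%:R)) ^+ 2.
Let V (j : nat) : R := (M%:R * W)^-1 * nm (dft M b.+1 w j) ^+ 2.

Let be_ge2 : 2 <= be. Proof. by rewrite /be -[2]/(2%:R) ler_nat. Qed.

Let WE : W = be * (be ^+ 4 - 1) / 30.
Proof. by rewrite /W window_mass -/be; field. Qed.

Let W_gt0 : 0 < W.
Proof.
rewrite WE; move: be be_ge2 => x x2.
rewrite divr_gt0// mulr_gt0//; first by lra.
by rewrite subr_gt0 exprn_egt1//; lra.
Qed.

Let V_ge0 j : 0 <= V j.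
Proof. by rewrite mulr_ge0 ?sqr_ge0// invr_ge0 mulr_ge0// ltW. Qed.

Let nm_w s : nm (w s) ^+ 2 = (s%:R * (be - s%:R)) ^+ 2.
Proof. by rewrite nm_real real_normK// num_real. Qed.

Let V_sum : \sum_(j < M) V j = 1.
Proof.
rewrite -mulr_sumr parseval//; last by lia.
under eq_bigr do rewrite nm_w.
by rewrite -/W mulVf// gt_eqF// mulr_gt0.
Qed.

(* The window [w] is a parabola because its gradient and its mass are explicit,
   with quotient [10 / (be ^+ 2 + 1)]. *)
Let V_moment : \sum_(j < M) V j * nm (ch j%:Z - 1) ^+ 2 <= 10 / b%:R ^+ 2.
Proof.
pose dw (s : nat) : C := if s is s'.+1 then ((be - 1 - 2 * s'%:R)%:C)%C else 0.
have E j : (1 - ch j%:Z) * dft M b.+1 w j = dft M b.+2 dw j.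
  rewrite /dft [RHS]big_ord_recl/= mul0r add0r mulrBl mul1r.
  have e1 : \sum_(s < b.+1) w s * ch (s%:Z * j%:Z) =
      \sum_(s < b.+1) w s.+1 * ch (s.+1%:Z * j%:Z).
    have : \sum_(s < b.+2) w s * ch (s%:Z * j%:Z) = \sum_(s < b.+2) w s * ch (s%:Z * j%:Z) by [].
    rewrite [LHS]big_ord_recr [RHS]big_ord_recl/= /w -/be subrr mulr0 mul0r !mul0r add0r addr0.
    by [].
  rewrite {1}e1 mulr_sumr -sumrB; apply: eq_bigr => s _.
  rewrite /bump/= add1n.
  have -> : s.+1%:Z * j%:Z = s%:Z * j%:Z + j%:Z by lia.
  have -> : ((be - 1 - 2 * s%:R)%:C)%C = w s.+1 - w s.
    by rewrite /w -rmorphB -natr1; congr real_complex_def; ring.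
  by rewrite ccharD; ring.
have -> : \sum_(j < M) V j * nm (ch j%:Z - 1) ^+ 2 =
    (M%:R * W)^-1 * \sum_(j < M) nm (dft M b.+2 dw j) ^+ 2.
  rewrite mulr_sumr; apply: eq_bigr => j _.
  by rewrite -E nmM exprMn -(nmN (ch _ - 1)) opprB /V; ring.
rewrite parseval//; last by lia.
have -> : \sum_(s < b.+2) nm (dw s) ^+ 2 = \sum_(s < b.+1) (be - 1 - 2 * s%:R) ^+ 2.
  rewrite big_ord_recl [X in X + _](_ : _ = 0); last by rewrite nm0 expr0n.
  rewrite add0r; apply: eq_bigr => s _.
  by rewrite [dw _]/((be - 1 - 2 * s%:R)%:C)%C nm_real real_normK// num_real.
rewrite window_gradient WE -/be.
have bb : b%:R = be - 1 by rewrite /be -natr1 addrK.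
rewrite bb; have := be_ge2; move: (be) => x x2.
have -> : (M%:R * (x * (x ^+ 4 - 1) / 30))^-1 * (M%:R * (x * (x - 1) ^+ 2 -
   2 * (x - 1) * x * (x - 1) + 2 * x * (x - 1) * (2 * x - 1) / 3)) = 10 / (x ^+ 2 + 1).
  have x1 : 0 < x ^+ 4 - 1 by rewrite subr_gt0 exprn_egt1//; lra.
  have x20 : 0 < x ^+ 2 + 1 by rewrite ltr_wpDl ?sqr_ge0.
  have x0 : 0 < x by lra.
  by field; rewrite !gt_eqF.
rewrite ler_pM2l// lef_pV2 ?posrE ?exprn_gt0//; [|nra|lra].
by nra.
Qed.

Let V_char r : (b <= `|r| <= M - b)%N ->
  \sum_(j < M) ((V j)%:C)%C * ch (r * j%:Z) = 0.
Proof.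
move=> /andP[r1 r2].
have -> : \sum_(j < M) ((V j)%:C)%C * ch (r * j%:Z) =
   (((M%:R * W)^-1)%:C)%C * \sum_(j < M) dft M b.+1 w j * ((dft M b.+1 w j)^*)%C * ch (r * j%:Z).
  rewrite mulr_sumr; apply: eq_bigr => j _.
  have rc (x y : R) : ((x * y)%:C)%C = (x%:C)%C * (y%:C)%C by exact: rmorphM.
  by rewrite /V rc nm_sqrC -[LHS]mulrA.
rewrite sum_dft big1 ?mulr0// => s _; rewrite big1// => t _.
have w0 : w 0 = 0 by rewrite /w mul0r.
have [->|s0] := posnP s; first by rewrite w0 !mul0r.
have [->|t0] := posnP t; first by rewrite w0 conjc0 mulr0 mul0r.
rewrite sum_cchar0 ?mulr0//.
by have := ltn_ord s; have := ltn_ord t; lia.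
Qed.

(** The density [V] is a kernel of Jackson type: it is nonnegative of mass one,
    its spectrum lies below [b], and its second moment is of order [b ^- 2].
    Hence [phi] is the average against [V] of its own differences
    [phi y - phi (y + j)], and shifting a block by [j] changes at most [2 j] of
    the summands. *)
Lemma bsum_bound q phi B x : band M b (M - b) phi -> (forall y, nm (phi y) <= B) ->
  nm (bsum q phi x) <= 6 * (M%:R / b%:R) * B.
Proof.
move=> bphi hB; have B0 : 0 <= B by apply: le_trans (hB 0%N); exact: nm_ge0.
have b0 : 0 < b%:R :> R by rewrite ltr0n.
have zero y : \sum_(j < M) ((V j)%:C)%C * phi (y + j)%N = 0.
  have [S [hS hphi]] := bphi.
  rewrite (kernel_multiplier y hphi (K := fun j => ((V j)%:C)%C) (mu := fun=> 0)).
    by rewrite big1// => r _; rewrite !mul0r.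
  by move=> r /hS; exact: V_char.
have E : bsum q phi x =
    \sum_(j < M) ((V j)%:C)%C * (bsum q phi x - bsum q phi (x + j)%N).
  under eq_bigr do rewrite mulrBr.
  rewrite sumrB -mulr_suml -rmorph_sum/= V_sum mul1r.
  rewrite (_ : \sum_(j < M) _ = 0) ?subr0//.
  under eq_bigr do rewrite /bsum mulr_sumr.
  rewrite exchange_big/= big1// => m _.
  by rewrite -[RHS](zero (x + m)%N); apply: eq_bigr => j _; rewrite addnAC.
rewrite E; apply: (le_trans (nm_sum _ _ _)).
apply: (@le_trans _ _ (\sum_(j < M) M%:R * B *
    ((b%:R * (V j * nm (ch j%:Z - 1) ^+ 2) + b%:R^-1 * V j) / 2))).
  apply: ler_sum => j _; rewrite nmM nm_real ger0_norm//.
  have h := bsum_cyclic_shift q x bphi hB (ltnW (ltn_ord j)).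
  have c := cchar_chord R M_gt0 (ltnW (ltn_ord j)).
  apply: (@le_trans _ _ (V j * (M%:R * nm (ch j%:Z - 1) * B))).
    rewrite ler_wpM2l//; apply: (le_trans h); rewrite ler_wpM2r//.
    by rewrite -ler_pdivrMl// mulrC.
  have -> : M%:R * B * ((b%:R * (V j * nm (ch j%:Z - 1) ^+ 2) + b%:R^-1 * V j) / 2) =
    V j * (M%:R * ((b%:R * nm (ch j%:Z - 1) ^+ 2 + b%:R^-1) / 2) * B) by ring.
  rewrite ler_wpM2l// ler_wpM2r// ler_wpM2l//.
  move: (nm _) => y.
  have -> : (b%:R * y ^+ 2 + b%:R^-1) / 2 = y + b%:R^-1 * (b%:R * y - 1) ^+ 2 / 2.
    by field; rewrite gt_eqF.
  by rewrite lerDl divr_ge0// mulr_ge0 ?sqr_ge0// invr_ge0 ltW.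
rewrite -mulr_sumr -mulr_suml big_split/=.
rewrite -[X in X + _]mulr_sumr -[X in _ + X]mulr_sumr V_sum mulr1.
have -> : 6 * (M%:R / b%:R) * B = M%:R * B * (6 / b%:R) by ring.
rewrite ler_wpM2l ?mulr_ge0//.
have m := V_moment; rewrite -(ler_pM2l b0) in m.
move: (\sum_(_ < _) _) m => z.
have -> : b%:R * (10 / b%:R ^+ 2) = 10 * b%:R^-1 :> R by field; rewrite gt_eqF.
have : 0 < b%:R^-1 :> R by rewrite invr_gt0.
by move: (_^-1) (b%:R * z) => u v ? ?; lra.
Qed.
End window.
End block_sums.

(** * Dyadic differences of a Littlewood-Paley piece *)

Section dyadic_operators.
Variable R : realType.
Local Notation C := R[i].
Implicit Types (phi : nat -> C) (B : R).

Definition block_mean (s : nat) phi (t : nat) : C :=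
  (2 ^ s)%:R^-1 * bsum (2 ^ s) phi (t * 2 ^ s).

Definition dyadic_mean (s : nat) phi (y : nat) : C := block_mean s phi (y %/ 2 ^ s).

Definition flip (t : nat) : nat := if odd t then t.-1 else t.+1.

(** The point at the same place in the other half of the parent block. *)
Definition sibling (s y : nat) : nat := (flip (y %/ 2 ^ s) * 2 ^ s + y %% 2 ^ s)%N.

(** The coarsest average counts as the last difference, so that the family for
    [s <= N] controls the whole function. *)
Definition dyadic_diff (N s : nat) phi (y : nat) : C :=
  if (s < N)%N then (dyadic_mean s phi y - dyadic_mean s phi (sibling s y)) / 2
  else dyadic_mean N phi y.

Lemma flipK : involutive flip.
Proof. by move=> t; rewrite /flip; case: ifP; case: ifP; lia. Qed.

Lemma divn_sibling s y : (sibling s y %/ 2 ^ s = flip (y %/ 2 ^ s))%N.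
Proof.
have q0 : (0 < 2 ^ s)%N by rewrite expn_gt0.
by rewrite /sibling divnMDl// (divn_small (ltn_pmod _ q0)) addn0.
Qed.

Lemma siblingK s : involutive (sibling s).
Proof.
move=> y; rewrite {1}/sibling divn_sibling flipK.
by rewrite {1}/sibling modnMDl modn_mod -divn_eq.
Qed.

Lemma sibling_lt N s y : (s < N)%N -> (y < 2 ^ N)%N -> (sibling s y < 2 ^ N)%N.
Proof.
move=> sN yN.
have E : (2 ^ N = 2 * 2 ^ (N - s.+1) * 2 ^ s)%N.
  by rewrite -expnS -expnD; congr expn; lia.
have yt : (y %/ 2 ^ s < 2 * 2 ^ (N - s.+1))%N by rewrite ltn_divLR ?expn_gt0// -E.
have yf : (flip (y %/ 2 ^ s) < 2 * 2 ^ (N - s.+1))%N by move: yt; rewrite /flip; case: ifP; lia.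
rewrite E /sibling; have : (y %% 2 ^ s < 2 ^ s)%N by rewrite ltn_pmod// expn_gt0.
move: (flip (y %/ 2 ^ s)%N) (y %% 2 ^ s)%N (2 ^ s)%N (2 * 2 ^ (N - s.+1))%N yf.
by move=> t m q Q; nia.
Qed.

Lemma dyadic_mean0 phi y : dyadic_mean 0 phi y = phi y.
Proof.
by rewrite /dyadic_mean /block_mean /bsum expn0 divn1 muln1 big_ord1 addn0 invr1 mul1r.
Qed.

Lemma dyadic_meanS s phi y :
  dyadic_mean s.+1 phi y = (dyadic_mean s phi y + dyadic_mean s phi (sibling s y)) / 2.
Proof.
rewrite /dyadic_mean divn_sibling expnSr divnMA divn2.
move: (y %/ 2 ^ s)%N => t.
have q0 : (2 ^ s)%:R != 0 :> C by rewrite pnatr_eq0 -lt0n expn_gt0.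
have H u : block_mean s.+1 phi u = (block_mean s phi u.*2 + block_mean s phi u.*2.+1) / 2.
  rewrite /block_mean /bsum expnSr.
  have -> : \sum_(m < 2 ^ s * 2) phi (u * (2 ^ s * 2) + m)%N =
      \sum_(m < 2 ^ s) phi (u.*2 * 2 ^ s + m)%N + \sum_(m < 2 ^ s) phi (u.*2.+1 * 2 ^ s + m)%N.
    rewrite muln2 -addnn big_split_ord/=; congr (_ + _); apply: eq_bigr => m _; congr phi; nia.
  by rewrite natrM; field.
rewrite H /flip; case: ifP => t2.
  have -> : (t./2.*2 = t.-1)%N by lia.
  have -> : t.-1.+1 = t by lia.
  by rewrite addrC.
by have -> : (t./2.*2 = t)%N by lia.
Qed.

Lemma nm_block_mean s phi B t : (forall y, nm (phi y) <= B) -> nm (block_mean s phi t) <= B.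
Proof.
move=> hB; rewrite /block_mean nmM nmV nm_nat ler_pdivrMl ?ltr0n ?expn_gt0//.
rewrite (le_trans (nm_sum _ _ _))// (le_trans (ler_sum _ (fun i _ => hB _)))//.
by rewrite sumr_const card_ord mulr_natl.
Qed.

Lemma block_mean_next s phi (de : R) t : (forall y, nm (phi y.+1 - phi y) <= de) ->
  nm (block_mean s phi t - block_mean s phi t.+1) <= (2 ^ s)%:R * de.
Proof.
move=> hde; rewrite /block_mean -mulrBr nmM nmV nm_nat ler_pdivrMl ?ltr0n ?expn_gt0//.
rewrite /bsum -sumrB (le_trans (nm_sum _ _ _))//.
have H y j : nm (phi y - phi (y + j)%N) <= j%:R * de.
  elim: j => [|j IH]; first by rewrite addn0 subrr nm0 mul0r.
  have -> : phi y - phi (y + j.+1)%N = (phi y - phi (y + j)%N) - (phi (y + j).+1 - phi (y + j)%N).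
    by rewrite addnS; ring.
  by rewrite (le_trans (nmB _ _))//; have := hde (y + j)%N; rewrite -natr1; lra.
apply: (@le_trans _ _ (\sum_(m < 2 ^ s) (2 ^ s)%:R * de)).
  apply: ler_sum => m _.
  have -> : (t.+1 * 2 ^ s + m = t * 2 ^ s + m + 2 ^ s)%N by rewrite mulSn; lia.
  exact: H.
by rewrite sumr_const card_ord -[leLHS]mulr_natl.
Qed.

(** The band of frequencies to which the [k]-th Littlewood-Paley piece is
    localized, on a grid with [2 ^ N] points. *)
Definition lp_band (N k : nat) (phi : nat -> C) : Prop :=
  band (2 ^ N) (if k is k'.+1 then 2 ^ k' else 0)%N (2 ^ k.+1)%N phi.

(** [2 ^ - |n - k|], with the distance as a sum of truncated differences. *)
Definition offdiag (n k : nat) : R := 2^-1 ^+ ((n - k) + (k - n)).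

(** Blocks of size [2 ^ s] have length [2 ^ - (N - s)] on the torus. On scales
    finer than [2 ^ - k], neighbouring blocks carry nearly the same values; on
    coarser ones the values nearly cancel within each block. *)
Lemma dyadic_diff_bound N s k phi B y : (k + 3 <= N)%N -> (s <= N)%N ->
  lp_band N k phi -> (forall y, nm (phi y) <= B) ->
  nm (dyadic_diff N s phi y) <= 140 * offdiag (N - s) k * B.
Proof.
move=> kN sN bphi hB.
have B0 : 0 <= B by apply: le_trans (hB 0%N); exact: nm_ge0.
have M0 : (0 < 2 ^ N)%N by rewrite expn_gt0.
have N8 : (2 ^ k * 8 <= 2 ^ N)%N by rewrite -[8%N]/(2 ^ 3)%N -expnD leq_exp2l.
have p0 n : 0 < 2 ^+ n :> R by rewrite exprn_gt0.
have half x1 x2 (D : R) : nm x1 <= D -> nm x2 <= D -> nm ((x1 - x2) / 2 : C) <= D.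
  move=> h1 h2; rewrite nmM nmV nm_nat ler_pdivrMr//.
  by rewrite (le_trans (nmB _ _))//; lra.
have [nk|kn] := ltnP (N - s) k; last first.
  have [sN'|] := ltnP s N; last first.
    move=> Ns; have {Ns} sN' : s = N by lia.
    have -> : dyadic_diff N s phi y = dyadic_mean N phi y by rewrite /dyadic_diff sN' ltnn.
    have -> : offdiag (N - s) k = 1 by rewrite /offdiag (_ : _ + _ = 0)%N ?expr0//; lia.
    by rewrite mulr1 (le_trans (nm_block_mean _ _ hB))//; lra.
  rewrite /dyadic_diff sN' /dyadic_mean divn_sibling.
  have b0 : band (2 ^ N) 0 (2 ^ k.+1) phi.
    have [S [hS hphi]] := bphi; exists S; split => // p /hS.
    by case/andP.
  set t := (y %/ 2 ^ s)%N.
  have E : (2 ^ s)%:R * (140 * (2 ^ k.+1)%:R / (2 ^ N)%:R * B) = 2 * (140 * offdiag (N - s) k * B).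
    rewrite /offdiag (_ : k - (N - s) = 0)%N ?addn0; last by lia.
    have -> : N = (s + k + (N - s - k))%N by lia.
    rewrite (_ : s + k + (N - s - k) - s - k = N - s - k)%N; last by lia.
    rewrite !natrX !exprD exprS exprVn; field.
    by rewrite !gt_eqF.
  have G u : nm (block_mean s phi u - block_mean s phi u.+1) <= 2 * (140 * offdiag (N - s) k * B).
    rewrite -E; apply: block_mean_next => z; apply: bernstein => //; last by rewrite expn_gt0.
    by rewrite expnS; lia.
  rewrite nmM nmV nm_nat ler_pdivrMr// mulrC.
  rewrite /flip; case: ifP => ot; last exact: G.
  by rewrite -nmN opprB; have := G t.-1; rewrite prednK//; lia.
case: k kN bphi N8 nk => [//|k] kN bphi N8 nk.
have bb : band (2 ^ N) (2 ^ k) (2 ^ N - 2 ^ k) phi.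
  have [S [hS hphi]] := bphi; exists S; split => // p /hS /andP[-> h]/=.
  by apply: (leq_trans h); move: N8; rewrite !expnS; lia.
have G q x : nm (bsum q phi x) <= 6 * ((2 ^ N)%:R / (2 ^ k)%:R) * B.
  apply: (bsum_bound M0 _ _ _ _ bb hB); first by rewrite expn_gt0.
  by move: N8; rewrite expnS; have := expn_gt0 2 k; lia.
have H t : nm (block_mean s phi t) <= 140 * offdiag (N - s) k.+1 * B.
  rewrite /block_mean nmM nmV nm_nat ler_pdivrMl ?ltr0n ?expn_gt0//.
  apply: (le_trans (G _ _)); rewrite [leRHS]mulrA ler_wpM2r//.
  apply: (@le_trans _ _ ((2 ^ s)%:R * (12 * offdiag (N - s) k.+1))); last first.
    rewrite ler_wpM2l// ler_wpM2r//; last by lra.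
    by rewrite exprn_ge0// invr_ge0.
  rewrite /offdiag (_ : N - s - k.+1 = 0)%N; last by lia.
  rewrite add0n le_eqVlt; apply/orP; left; apply/eqP.
  have ek : 2 * 2 ^+ k = 2 ^+ (N - s) * 2 ^+ (k.+1 - (N - s)) :> R.
    by rewrite -exprS -exprD; congr (_ ^+ _); lia.
  have -> : (2 ^ N)%:R = (2 ^ s)%:R * 2 ^+ (N - s) :> R.
    by rewrite !natrX -exprD; congr (_ ^+ _); lia.
  rewrite (natrX _ 2 k) (_ : 2 ^+ k = 2 ^+ (N - s) * 2 ^+ (k.+1 - (N - s)) / 2); last by lra.
  have q0 : 0 < (2 ^ s)%:R :> R by rewrite ltr0n expn_gt0.
  by rewrite exprVn; field; rewrite !gt_eqF.
rewrite /dyadic_diff; case: ifPn => sN2; first by apply: half; exact: H.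
have sN' : s = N by lia.
have -> : dyadic_mean N phi y = dyadic_mean s phi y by rewrite sN'.
exact: H.
Qed.
End dyadic_operators.

(** * Martingale differences in several variables *)

Section schur.
Variable R : realType.

Lemma offdiagC n k : offdiag R n k = offdiag R k n.
Proof. by rewrite /offdiag addnC. Qed.

Lemma offdiag_ge0 n k : 0 <= offdiag R n k.
Proof. by rewrite exprn_ge0// invr_ge0. Qed.

Lemma sum_offdiag n K : \sum_(k < K) offdiag R n k <= 3.
Proof.
suff : \sum_(k < K) offdiag R n k <=
    if (K <= n)%N then 2^-1 ^+ (n - K) else 3 - 2 * 2^-1 ^+ (K - n).
  move=> /le_trans; apply; case: ifP => _.
    apply: (@le_trans _ _ 1); last by lra.
    by rewrite exprn_ile1 ?invr_ge0//; lra.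
  have : 0 <= 2^-1 ^+ (K - n) :> R by rewrite exprn_ge0// invr_ge0.
  lra.
elim: K => [|K IH]; first by rewrite big_ord0 leq0n exprn_ge0// invr_ge0.
rewrite big_ord_recr/=; move: IH; case: (ltngtP K n) => [Kn|nK|->] IH.
- have e : (n - K = (n - K.+1).+1)%N by lia.
  rewrite /offdiag (_ : (K - n = 0)%N) ?addn0; last by lia.
  by move: IH; rewrite e exprS; move: (_ ^+ _) => z; lra.
- rewrite /offdiag (_ : (n - K = 0)%N) ?add0n; last by lia.
  have e : (K.+1 - n = (K - n).+1)%N by lia.
  by move: IH; rewrite e exprS; move: (_ ^+ _) => z; lra.
- move: IH; rewrite /offdiag subnn expr0 subSnn expr1; lra.
Qed.

(** Schur's test: the rows and the columns of the kernel have sum at most 3. *)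
Lemma schur_offdiag N K (a : 'I_K -> R) :
  \sum_(s < N.+1) (\sum_(k < K) offdiag R (N - s) k * a k) ^+ 2 <= 9 * \sum_(k < K) a k ^+ 2.
Proof.
have row n : (\sum_(k < K) offdiag R n k * a k) ^+ 2 <= 3 * \sum_(k < K) offdiag R n k * a k ^+ 2.
  set S := \sum_(k < K) _ * a k.
  have : \sum_(k < K) offdiag R n k * (2 * (S / 3) * a k) <=
      \sum_(k < K) (offdiag R n k * a k ^+ 2 + offdiag R n k * (S / 3) ^+ 2).
    apply: ler_sum => k _; rewrite -mulrDr ler_wpM2l ?offdiag_ge0//.
    by have := sqr_ge0 (a k - S / 3); lra.
  rewrite big_split/= -mulr_suml.
  have -> : \sum_(k < K) offdiag R n k * (2 * (S / 3) * a k) = 2 * (S / 3) * S.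
    transitivity (\sum_(k < K) 2 * (S / 3) * (offdiag R n k * a k)).
      by apply: eq_bigr => k _; ring.
    by rewrite -mulr_sumr.
  have := sum_offdiag n K.
  move: (\sum_(k < K) offdiag R n k) (\sum_(k < K) offdiag R n k * a k ^+ 2) => W T W3 h.
  have : W * (S / 3) ^+ 2 <= 3 * (S / 3) ^+ 2 by rewrite ler_wpM2r ?sqr_ge0.
  by lra.
apply: (@le_trans _ _ (\sum_(s < N.+1) 3 * \sum_(k < K) offdiag R (N - s) k * a k ^+ 2)).
  by apply: ler_sum => s _; exact: row.
rewrite -mulr_sumr exchange_big/=.
have -> : 9 * \sum_(k < K) a k ^+ 2 = 3 * \sum_(k < K) 3 * a k ^+ 2.
  by rewrite -mulr_sumr; ring.
rewrite ler_wpM2l// ler_sum// => k _.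
rewrite -mulr_suml ler_wpM2r ?sqr_ge0//.
rewrite (reindex_inj rev_ord_inj)/=.
rewrite (eq_bigr (fun s : 'I_N.+1 => offdiag R k s)); first exact: sum_offdiag.
by move=> s _; rewrite offdiagC; congr offdiag; have := ltn_ord s; lia.
Qed.
End schur.

Section functionals.
Variables (R : realType).
Local Notation C := R[i].

(** Operators given by such functionals act on slices of a function of several
    variables and preserve every linear condition on its slices in the other
    variables. *)
Definition finite_functional (L : (nat -> C) -> C) : Prop :=
  exists r : seq (nat * C), forall phi, L phi = \sum_(p <- r) p.2 * phi p.1.

Lemma finite_functional_eval y : finite_functional (fun phi => phi y).
Proof. by exists [:: (y, 1)] => phi; rewrite big_seq1 mul1r. Qed.

Lemma finite_functionalZ c L : finite_functional L -> finite_functional (fun phi => c * L phi).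
Proof.
move=> [r hr]; exists [seq (p.1, c * p.2) | p <- r] => phi.
by rewrite hr big_map mulr_sumr; apply: eq_bigr => p _; rewrite mulrA.
Qed.

Lemma finite_functionalD L1 L2 : finite_functional L1 -> finite_functional L2 ->
  finite_functional (fun phi => L1 phi + L2 phi).
Proof. by move=> [r1 h1] [r2 h2]; exists (r1 ++ r2) => phi; rewrite h1 h2 big_cat. Qed.

Lemma finite_functional_sum n (L : nat -> (nat -> C) -> C) :
  (forall m, finite_functional (L m)) -> finite_functional (fun phi => \sum_(m < n) L m phi).
Proof.
move=> hL; elim: n => [|n IH]; first by exists [::] => phi; rewrite big_ord0 big_nil.
have [r hr] := finite_functionalD IH (hL n).
by exists r => phi; rewrite big_ord_recr/= hr.
Qed.

Lemma dyadic_diff_finite N s y : finite_functional (fun phi => dyadic_diff N s phi y).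
Proof.
have mean n z : finite_functional (fun phi => dyadic_mean n phi z).
  rewrite /dyadic_mean /block_mean /bsum.
  apply: finite_functionalZ.
  apply: (@finite_functional_sum (2 ^ n) (fun m phi => phi (z %/ 2 ^ n * 2 ^ n + m)%N)) => m.
  exact: finite_functional_eval.
rewrite /dyadic_diff; case: (s < N)%N; last exact: mean.
have [r hr] := finite_functionalZ 2^-1 (finite_functionalD (mean s y)
   (finite_functionalZ (-1) (mean s (sibling s y)))).
by exists r => phi; rewrite -hr mulN1r mulrC.
Qed.

Lemma finite_functional_linear L (I : Type) (r : seq I) (G : I -> nat -> C) :
  finite_functional L -> L (fun y => \sum_(i <- r) G i y) = \sum_(i <- r) L (G i).
Proof.
move=> [t ht]; rewrite ht; under [RHS]eq_bigr do rewrite ht.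
by rewrite exchange_big/=; apply: eq_bigr => p _; rewrite mulr_sumr.
Qed.

Lemma band_sum M lo hi (I : Type) (r : seq I) (G : I -> nat -> C) :
  (forall i, band M lo hi (G i)) -> band M lo hi (fun y => \sum_(i <- r) G i y).
Proof.
move=> hG; elim: r => [|i r [S [hS IH]]].
  by exists [::]; split => // y; rewrite !big_nil.
have [S1 [hS1 h1]] := hG i; exists (S1 ++ S); split=> [p|y].
  by rewrite mem_cat => /orP[/hS1|/hS].
by rewrite big_cons IH h1 big_cat.
Qed.

Lemma bandZ M lo hi c (phi : nat -> C) :
  band M lo hi phi -> band M lo hi (fun y => c * phi y).
Proof.
move=> [S [hS h]]; exists [seq (p.1, c * p.2) | p <- S]; split=> [p|y].
  by move=> /mapP[q /hS ? ->].
by rewrite h big_map mulr_sumr; apply: eq_bigr => p _; rewrite mulrA.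
Qed.
End functionals.

Section grid.
Variables (R : realType) (d N : nat).
Local Notation C := R[i].
Local Notation pt := ('I_d -> nat).
Local Notation J := {ffun 'I_d -> 'I_(2 ^ N)}.
Implicit Types (F : pt -> C) (x : pt) (i : 'I_d) (p : R).

Definition upd x i (y : nat) : pt := fun j => if j == i then y else x j.

Lemma upd_upd x i y z : upd (upd x i y) i z = upd x i z.
Proof. by apply/funext => j; rewrite /upd; case: eqP. Qed.

Lemma upd_same x i y : upd x i y i = y.
Proof. by rewrite /upd eqxx. Qed.

Lemma upd_id x i : upd x i (x i) = x.
Proof. by apply/funext => j; rewrite /upd; case: eqP => // ->. Qed.

Lemma upd_comm x i j y z : i != j -> upd (upd x i y) j z = upd (upd x j z) i y.
Proof.
move=> ij; apply/funext => k; rewrite /upd; case: (eqVneq k j) => // -> .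
by rewrite eq_sym (negbTE ij).
Qed.

Lemma upd_other x i j y : j != i -> upd x i y j = x j.
Proof. by move=> ji; rewrite /upd (negbTE ji). Qed.

Definition along i (T : (nat -> C) -> nat -> C) F : pt -> C :=
  fun x => T (fun z => F (upd x i z)) (x i).

Definition grid_pt (x : J) : pt := fun i => x i.

(** The square of the normalized [L^p] norm on the grid, as the [L^(p/2)] norm
    of [|F|^2]. *)
Definition gnorm p F : R :=
  wnorm (#|J|%:R^-1) (p / 2)
    (fun x : J => nm (F (grid_pt x)) ^+ 2).

Let card_grid : 0 < #|J|%:R :> R.
Proof. by rewrite ltr0n card_ffun !card_ord !expn_gt0. Qed.

Lemma gnorm_ge0 p F : 0 <= gnorm p F.
Proof. exact: wnorm_ge0. Qed.

Lemma gnorm_sup p F (a : R) : 2 <= p -> (forall x, nm (F x) <= a) -> gnorm p F <= a ^+ 2.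
Proof.
move=> p2 hF; have q0 : 0 <= p / 2 by lra.
have q1 : p / 2 != 0 by rewrite gt_eqF//; lra.
apply: (@le_trans _ _ (wnorm (#|J|%:R^-1) (p / 2)
    (fun x : J => a ^+ 2))).
  apply: le_wnorm; rewrite ?invr_ge0 ?ler0n// => x; first exact: sqr_ge0.
  by rewrite lerXn2r ?nnegrE ?nm_ge0// (le_trans _ (hF (grid_pt x)))// nm_ge0.
rewrite /wnorm sumr_const -[X in _ * X]mulr_natl mulKf ?gt_eqF//.
by rewrite -powRrM mulfV// powRr1// sqr_ge0.
Qed.

(** The involutions of [wnorm_martingale] act on the coordinate [i]; the last
    average is absorbed in the sum since [11 * p >= 1]. *)
Lemma gnorm_martingale p i F : 2 <= p ->
  gnorm p F <= 11 * p * \sum_(s < N.+1) gnorm p (along i (dyadic_diff N s) F).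
Proof.
move=> p2.
pose sg s (x : J) : J :=
  [ffun j => if j == i then insubd (x i) (sibling s (x i)) else x j].
have sgE s (x : J) : (s < N)%N -> grid_pt (sg s x) = upd (grid_pt x) i (sibling s (x i)).
  move=> sN; apply/funext => j; rewrite /grid_pt /upd ffunE; case: eqP => // _.
  by rewrite val_insubd sibling_lt.
have sgK s : (s < N)%N -> involutive (sg s).
  move=> sN x; apply/ffunP => j; apply: val_inj.
  have := congr1 (fun f : pt => f j) (sgE s (sg s x) sN).
  rewrite /grid_pt/= => ->.
  have E : (sg s x i : nat) = sibling s (x i).
    by have := congr1 (fun f : pt => f i) (sgE s x sN); rewrite /grid_pt upd_same.
  rewrite E siblingK /upd; case: eqP => [->//|/eqP ji].
  by have := congr1 (fun f : pt => f j) (sgE s x sN); rewrite /grid_pt upd_other.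
pose A s (x : J) := along i (dyadic_mean s) F (grid_pt x).
have Asg s (x : J) : (s < N)%N ->
    A s (sg s x) = dyadic_mean s (fun z => F (upd (grid_pt x) i z)) (sibling s (x i)).
  move=> sN; rewrite /A /along sgE// upd_same; congr dyadic_mean.
  by apply/funext => z; rewrite upd_upd.
have AS s (x : J) : (s < N)%N -> A s.+1 x = (A s x + A s (sg s x)) / 2.
  by move=> sN; rewrite Asg// /A /along dyadic_meanS.
have c0 : 0 <= #|J|%:R^-1 :> R by rewrite invr_ge0 ltW.
have dE s : (s < N)%N -> (fun x : J => nm ((A s x - A s (sg s x)) / 2) ^+ 2) =
    (fun x : J => nm (along i (dyadic_diff N s) F (grid_pt x)) ^+ 2).
  by move=> sN; apply/funext => x; rewrite Asg// /A /along /dyadic_diff sN.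
have H := wnorm_martingale c0 p2 sgK AS.
have AN : (fun x : J => nm (A N x) ^+ 2) =
    (fun x : J => nm (along i (dyadic_diff N N) F (grid_pt x)) ^+ 2).
  by apply/funext => x; rewrite /A /along /dyadic_diff ltnn.
have A0 : (fun x : J => nm (A 0%N x) ^+ 2) = fun x : J => nm (F (grid_pt x)) ^+ 2.
  by apply/funext => x; rewrite /A /along dyadic_mean0 upd_id.
have SE : \sum_(s < N) wnorm #|J|%:R^-1 (p / 2)
    (fun x : J => nm ((A s x - A s (sg s x)) / 2) ^+ 2) =
    \sum_(s < N) gnorm p (along i (dyadic_diff N s) F).
  by apply: eq_bigr => s _; rewrite (dE s (ltn_ord s)).
rewrite A0 AN SE -/(gnorm p F) -/(gnorm p (along i (dyadic_diff N N) F)) in H.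
apply: (le_trans H) => {H}; rewrite big_ord_recr/=.
have := gnorm_ge0 p (along i (dyadic_diff N N) F).
move: (gnorm p (along i (dyadic_diff N N) F)) (\sum_(s < N) _) => g S g0.
clear -p2 g0; rewrite mulrDr [leRHS]addrC lerD2r ler_peMl//.
by lra.
Qed.

Fixpoint iterated_square p (l : seq 'I_d) F : R :=
  if l is i :: l' then
    \sum_(s < N.+1) iterated_square p l' (along i (dyadic_diff N s) F)
  else gnorm p F.

Lemma gnorm_iterated p l F : 2 <= p ->
  gnorm p F <= (11 * p) ^+ size l * iterated_square p l F.
Proof.
move=> p2; have p0 : 0 <= 11 * p by lra.
elim: l F => [|i l IH] F/=; first by rewrite mul1r.
rewrite (le_trans (gnorm_martingale i F p2))// exprS -[leRHS]mulrA ler_wpM2l//.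
by rewrite mulr_sumr ler_sum.
Qed.
End grid.

(** * The estimate on a grid *)

Section grid_bound.
Variables (R : realType) (d N K : nat).
Local Notation C := R[i].
Local Notation pt := ('I_d -> nat).
Implicit Types (F : pt -> C) (x : pt) (i : 'I_d) (p : R).

Lemma sum_tuple_cons (V : nmodType) n (phi : n.+1.-tuple 'I_K -> V) :
  \sum_k phi k = \sum_(k < K) \sum_(t : n.-tuple 'I_K) phi [tuple of k :: t].
Proof.
rewrite pair_big/= (reindex (fun u : 'I_K * n.-tuple 'I_K => [tuple of u.1 :: u.2]))//=.
exists (fun t : n.+1.-tuple 'I_K => (thead t, [tuple of behead t])) => [[k t] _|t _]/=.
  by congr pair; apply: val_inj.
by rewrite -tuple_eta.
Qed.

Definition sliced_band i k F : Prop := forall x, lp_band N k (fun y => F (upd x i y)).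

Lemma sliced_band_sum (I : finType) i k (G : I -> pt -> C) :
  (forall j, sliced_band i k (G j)) -> sliced_band i k (fun x => \sum_j G j x).
Proof. by move=> hG x; apply: band_sum => j; exact: hG. Qed.

(** The operator in the variable [i] forms linear combinations of the slices in
    the variable [j]. *)
Lemma sliced_band_along i j k s F : i != j -> sliced_band j k F ->
  sliced_band j k (along i (dyadic_diff N s) F).
Proof.
move=> ij hF x; rewrite /along /lp_band.
have -> : (fun y => dyadic_diff N s (fun z => F (upd (upd x j y) i z)) (upd x j y i)) =
    (fun y => dyadic_diff N s (fun z => F (upd (upd x i z) j y)) (x i)).
  apply/funext => y; rewrite upd_other//; congr dyadic_diff; apply/funext => z.
  by rewrite upd_comm// eq_sym.
have [r hr] := dyadic_diff_finite R N s (x i).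
have -> : (fun y => dyadic_diff N s (fun z => F (upd (upd x i z) j y)) (x i)) =
    (fun y => \sum_(q <- r) q.2 * F (upd (upd x i q.1) j y)) by apply/funext => y; rewrite hr.
by apply: (@band_sum _ _ _ _ _ r (fun q y => q.2 * F (upd (upd x i q.1) j y))) => q;
  apply: bandZ; exact: hF.
Qed.

Lemma along_sum (I : finType) i s (G : I -> pt -> C) x :
  along i (dyadic_diff N s) (fun x => \sum_j G j x) x =
  \sum_j along i (dyadic_diff N s) (G j) x.
Proof.
by rewrite /along; exact: (finite_functional_linear _ _ (dyadic_diff_finite R N s (x i))).
Qed.

(** One variable at a time: after taking differences in the first variable of
    [l], the functions [h s t] are still localized in the other ones, and
    Schur's test sums over the first index of [k] and over [s]. *)
Lemma iterated_square_bound p n (l : n.-tuple 'I_d)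
    (g : n.-tuple 'I_K -> pt -> C) (a : n.-tuple 'I_K -> R) :
  2 <= p -> (K + 2 <= N)%N -> uniq l ->
  (forall k x, nm (g k x) <= a k) ->
  (forall (k : n.-tuple 'I_K) j, sliced_band (tnth l j) (tnth k j) (g k)) ->
  iterated_square N p l (fun x => \sum_k g k x) <=
  (9 * 140 ^+ 2) ^+ n * \sum_k a k ^+ 2.
Proof.
move=> p2 KN; elim: n l g a => [|n IH] l g a.
  move=> _ ga _; rewrite (tuple0 l)/= mul1r.
  rewrite (big_pred1 [tuple]) => [|k]; last by rewrite [k]tuple0; apply/esym/eqP.
  apply: gnorm_sup => // x.
  by rewrite (big_pred1 [tuple]) => [|k]; last by rewrite [k]tuple0; apply/esym/eqP.
case: (tupleP l) => i {}l /= /andP[il lu] ga gb.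
pose h (s : nat) (t : n.-tuple 'I_K) : pt -> C :=
  fun x => \sum_(k < K) along i (dyadic_diff N s) (g [tuple of k :: t]) x.
pose b (s : nat) (t : n.-tuple 'I_K) : R :=
  140 * \sum_(k < K) offdiag R (N - s) k * a [tuple of k :: t].
have hE s : along i (dyadic_diff N s) (fun x => \sum_k g k x) = (fun x => \sum_t h s t x).
  apply/funext => x; rewrite along_sum sum_tuple_cons exchange_big/=.
  by [].
have hb (s : nat) t x : (s <= N)%N -> nm (h s t x) <= b s t.
  move=> sN; rewrite (le_trans (nm_sum _ _ _))// /b mulr_sumr ler_sum// => k _.
  rewrite mulrA; apply: dyadic_diff_bound => //.
  - by have := ltn_ord k; lia.
  - by have := gb [tuple of k :: t] ord0 x; rewrite !tnth0.
have hs (s : nat) (t : n.-tuple 'I_K) j : sliced_band (tnth l j) (tnth t j) (h s t).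
  apply: sliced_band_sum => k; apply: sliced_band_along.
    by apply: contraNneq il => ->; exact: mem_tnth.
  by have := gb [tuple of k :: t] (lift ord0 j); rewrite !tnthS.
apply: (@le_trans _ _ (\sum_(s < N.+1) (9 * 140 ^+ 2) ^+ n * \sum_t b s t ^+ 2)).
  apply: ler_sum => s _; rewrite hE; apply: IH => // t x; apply: hb.
  by have := ltn_ord s; lia.
rewrite -mulr_sumr [_ ^+ n.+1]exprSr -[leRHS]mulrA ler_wpM2l ?exprn_ge0 ?mulr_ge0//.
rewrite exchange_big/= sum_tuple_cons [X in _ <= _ * X]exchange_big/= mulr_sumr ler_sum// => t _.
rewrite /b; under eq_bigr do rewrite exprMn.
rewrite -mulr_sumr [leRHS](_ : _ = 140 ^+ 2 * (9 * \sum_(k < K) a [tuple of k :: t] ^+ 2));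
  last by rewrite mulrA [140 ^+ 2 * 9]mulrC.
by rewrite ler_wpM2l ?exprn_ge0//; exact: schur_offdiag.
Qed.

Lemma gnorm_bound p (g : d.-tuple 'I_K -> pt -> C) (a : d.-tuple 'I_K -> R) :
  2 <= p -> (K + 2 <= N)%N ->
  (forall k x, nm (g k x) <= a k) ->
  (forall (k : d.-tuple 'I_K) j, sliced_band j (tnth k j) (g k)) ->
  gnorm N p (fun x => \sum_k g k x) <=
  (11 * p * (9 * 140 ^+ 2)) ^+ d * \sum_k a k ^+ 2.
Proof.
move=> p2 KN ga gb.
apply: (le_trans (gnorm_iterated N (ord_tuple d) _ p2)).
rewrite size_tuple [(11 * p * _) ^+ d]exprMn -[leRHS]mulrA ler_wpM2l//.
  by rewrite exprn_ge0//; lra.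
apply: iterated_square_bound => //; first by rewrite val_ord_tuple enum_uniq.
by move=> k j; rewrite tnth_ord_tuple.
Qed.
End grid_bound.

(** * Riemann sums on the torus *)

Section riemann_sums.
Variables (R : realType) (d : nat).
Local Notation RT := (measurableTypeR R).
Local Notation T := (d.-tuple RT).
Local Notation mu := (torus_measure R d).

Definition tuple_box (A : 'I_d -> set RT) : set T := [set x | forall i, A i (tnth x i)].

Lemma measurable_tuple_box (A : 'I_d -> set RT) :
  (forall i, measurable (A i)) -> measurable (tuple_box A).
Proof.
move=> mA.
have -> : tuple_box A = \bigcap_(i in [set: 'I_d]) ((fun x : T => tnth x i) @^-1` A i).
  by apply/seteqP; split => x /= H i => [_|]; [exact: H|exact: (H i I)].
apply: fin_bigcap_measurable => // i _.
by rewrite -[X in measurable X]setTI; exact: measurable_tnth.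
Qed.

Lemma tuple_box_measure (A : 'I_d -> set RT) : (forall i, measurable (A i)) ->
  mu (tuple_box A) = (\prod_(i < d) lebesgue_measure (A i `&` `[0%R, 1%R[%classic))%E.
Proof. exact: torus_measure_box. Qed.

Definition unit_cube : set T := tuple_box (fun=> `[0, 1[%classic).

Lemma ae_unit_cube : \forall x \ae mu, unit_cube x.
Proof.
have mc : measurable unit_cube by apply: measurable_tuple_box.
have c1 : mu unit_cube = 1%E.
  rewrite tuple_box_measure// big1// => i _.
  by rewrite setIid lebesgue_measure_itv/= lte_fin ltr01 -EFinB subr0.
exists (~` unit_cube); split => //; first exact: measurableC.
by rewrite probability_setC// c1 subee.
Qed.

Section mesh.
Variable N : nat.
Local Notation M := (2 ^ N)%N.
Local Notation J := {ffun 'I_d -> 'I_M}.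

Definition mesh_box (j : J) : set T :=
  tuple_box (fun i => `[(j i)%:R / M%:R, (j i).+1%:R / M%:R[%classic).

Definition sample (x : 'I_d -> nat) : T := [tuple ((x i)%:R / M%:R : R) | i < d].

Let M0 : 0 < M%:R :> R. Proof. by rewrite ltr0n expn_gt0. Qed.

Lemma measurable_mesh_box j : measurable (mesh_box j).
Proof. by apply: measurable_tuple_box. Qed.

Lemma mesh_box_measure j : mu (mesh_box j) = (#|{: J}|%:R^-1)%:E.
Proof.
rewrite tuple_box_measure//.
rewrite (eq_bigr (fun=> (M%:R^-1)%:E)) => [|i _].
  rewrite prodEFin prodr_const card_ord; congr EFin.
  by rewrite card_ffun !card_ord (natrX _ (2 ^ N) d) exprVn.
rewrite setIidl.
  rewrite lebesgue_measure_itv/= lte_fin ltr_pM2r ?invr_gt0// ltr_nat ltnSn.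
  by rewrite -EFinB -mulrBl -natr1 addrAC subrr add0r mul1r.
move=> x/=; rewrite !in_itv/= => /andP[x0 x1]; apply/andP; split.
  by apply: le_trans x0; rewrite divr_ge0.
apply: (lt_le_trans x1); rewrite ler_pdivrMr// mul1r ler_nat.
exact: ltn_ord.
Qed.

Lemma mesh_cover x : unit_cube x -> exists j : J, mesh_box j x.
Proof.
move=> cx.
have h i : (Num.trunc (M%:R * tnth x i : R) < M)%N.
  have := cx i; rewrite /= in_itv/= => /andP[x0 x1].
  have Mx : 0 <= M%:R * tnth x i by rewrite mulr_ge0.
  have /andP[h1 _] := truncn_itv Mx.
  rewrite -(ltr_nat R); apply: (le_lt_trans h1).
  by rewrite -[ltRHS]mulr1 ltr_pM2l.
exists [ffun i => Ordinal (h i)] => i /=; rewrite ffunE in_itv/=.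
have := cx i; rewrite /= in_itv/= => /andP[x0 x1].
have : 0 <= M%:R * tnth x i by rewrite mulr_ge0.
move=> /truncn_itv/andP[h1 h2].
by rewrite ler_pdivrMr// ltr_pdivlMr// ![tnth x i * _]mulrC h1.
Qed.

Lemma mesh_sample_dist (j : J) x i : mesh_box j x ->
  `|(tnth x i : R) - tnth (sample (grid_pt j)) i| <= M%:R^-1.
Proof.
move=> /(_ i); rewrite /= in_itv/= tnth_mktuple /grid_pt -natr1 mulrDl mul1r => /andP[h1 h2].
by rewrite ger0_norm; lra.
Qed.

(** An upper Riemann sum; the half-open boxes of the mesh cover almost all of
    the torus and have equal measures. *)
Lemma integral_le_mesh (h : T -> R) (G : J -> R) : measurable_fun [set: T] h ->
  (forall x, 0 <= h x) -> (forall j, 0 <= G j) ->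
  (forall j x, mesh_box j x -> h x <= G j) ->
  (\int[mu]_x (h x)%:E <= (#|{: J}|%:R^-1 * \sum_j G j)%:E)%E.
Proof.
move=> mh h0 G0 hG.
have mG j : measurable_fun [set: T] (fun x : T => G j * \1_(mesh_box j) x : R).
  apply: measurable_funM => //.
  by apply: measurable_indic; exact: measurable_mesh_box.
apply: (@le_trans _ _ (\int[mu]_x (\sum_(j : J) (G j * \1_(mesh_box j) x)%:E))%E).
  apply: ae_ge0_le_integral => //.
  - by move=> x _; rewrite lee_fin.
  - exact/measurable_EFinP.
  - by move=> x _; apply: sume_ge0 => j _; rewrite lee_fin mulr_ge0.
  - by apply: emeasurable_sum => j; apply/measurable_EFinP.
  - apply: filterS ae_unit_cube => x /mesh_cover[j jx] _.
    rewrite (bigD1 j)//= indicE mem_set// mulr1 (le_trans (_ : _ <= (G j)%:E)%E)//.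
      by rewrite lee_fin hG.
    by rewrite leeDl// sume_ge0// => i _; rewrite lee_fin mulr_ge0.
rewrite ge0_integral_sum//; last 2 first.
- by move=> j; apply/measurable_EFinP; exact: mG.
- by move=> j x _; rewrite lee_fin mulr_ge0.
rewrite (eq_bigr (fun j => (#|{: J}|%:R^-1 * G j)%:E)).
  by rewrite sumEFin lee_fin mulr_sumr.
move=> j _; under eq_integral do rewrite EFinM.
have mI : measurable_fun [set: T] (fun x => (\1_(mesh_box j) x : R)%:E).
  by apply/measurable_EFinP; apply: measurable_indic; exact: measurable_mesh_box.
rewrite ge0_integralZl ?lee_fin//.
rewrite integral_indic//; last exact: measurable_mesh_box.
rewrite setIT [in RHS]mulrC EFinM; congr (_ * _)%E.
exact: mesh_box_measure.
Qed.
End mesh.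
End riemann_sums.

Section mean_values.
Variables (R : realType) (d : nat).
Local Notation T := (d.-tuple (measurableTypeR R)).
Local Notation mu := (torus_measure R d).

Lemma bounded_integrable (h : T -> R) (B : R) : measurable_fun [set: T] h ->
  (forall x, `|h x| <= B) -> mu.-integrable [set: T] (EFin \o h).
Proof.
move=> mh hB; apply: measurable_bounded_integrable => //.
  by rewrite (le_lt_trans (probability_le1 _ _))// ltry.
exists B; split; first exact: num_real.
by move=> y By x _; apply: le_trans (hB x) (ltW By).
Qed.

Lemma integral_mesh_mean N (h : T -> R) (B e : R) : measurable_fun [set: T] h ->
  (forall x, `|h x| <= B) ->
  (forall (j : {ffun 'I_d -> 'I_(2 ^ N)}) x, mesh_box j x ->
     `|h x - h (sample R N (grid_pt j))| <= e) ->
  `|\int[mu]_x h x - #|{: {ffun 'I_d -> 'I_(2 ^ N)}}|%:R^-1 *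
       \sum_(j : {ffun 'I_d -> 'I_(2 ^ N)}) h (sample R N (grid_pt j))| <= e.
Proof.
move=> mh hB he.
pose J := {ffun 'I_d -> 'I_(2 ^ N)}.
have cJ : 0 < #|J|%:R :> R by rewrite ltr0n card_ffun !card_ord !expn_gt0.
have upper (g : T -> R) : measurable_fun [set: T] g -> (forall x, `|g x| <= B) ->
    (forall (j : J) x, mesh_box j x -> `|g x - g (sample R N (grid_pt j))| <= e) ->
    \int[mu]_x g x <= #|J|%:R^-1 * \sum_(j : J) g (sample R N (grid_pt j)) + e.
  move=> mg gB ge.
  have gN x : - B <= g x by have := gB x; rewrite ler_norml => /andP[].
  have B0 : 0 <= B by apply: le_trans (gB (sample R N (fun=> 0%N))).
  have mgB : measurable_fun [set: T] (fun x => g x + B : R) by apply: measurable_funD.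
  have e0 : 0 <= e.
    have M0 : (0 < 2 ^ N)%N by rewrite expn_gt0.
    pose j : J := [ffun=> Ordinal M0].
    have jx : mesh_box j (sample R N (grid_pt j)).
      by move=> i /=; rewrite in_itv/= tnth_mktuple lexx/=
        ltr_pM2r ?invr_gt0 ?ltr0n ?expn_gt0// ltr_nat ltnSn.
    by apply: le_trans (ge j _ jx).
  have H : (\int[mu]_x (g x + B)%:E <=
      (#|J|%:R^-1 * \sum_(j : J) (g (sample R N (grid_pt j)) + e + B))%:E)%E.
    apply: integral_le_mesh => // [x|j|j x jx].
    - by have := gN x; lra.
    - by have := gN (sample R N (grid_pt j)); lra.
    - by have := ge j x jx; rewrite ler_norml => /andP[_]; lra.
  have : \int[mu]_x (g x + B) <=
      #|J|%:R^-1 * \sum_(j : J) (g (sample R N (grid_pt j)) + e + B).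
    rewrite /Rintegral -lee_fin fineK//.
    rewrite ge0_fin_numE; first by rewrite (le_lt_trans H)// ltry.
    by apply: integral_ge0 => x _; rewrite lee_fin; have := gN x; lra.
  rewrite RintegralD//; last 2 first.
  - exact: bounded_integrable gB.
  - by apply: (@bounded_integrable _ `|B|).
  rewrite Rintegral_cst// [X in fine X](probability_setT mu)/= mulr1.
  rewrite big_split big_split/= !sumr_const !mulrDr.
  have avg_cst (y : R) : #|J|%:R^-1 * (y *+ #|J|) = y.
    by rewrite -[y *+ _]mulr_natl mulKf ?gt_eqF.
  by rewrite !avg_cst lerD2r.
rewrite ler_norml; apply/andP; split; last first.
  by rewrite lerBlDl; exact: upper.
have : \int[mu]_x - h x <= #|J|%:R^-1 * \sum_(j : J) - h (sample R N (grid_pt j)) + e.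
  apply: upper => [|x|j x jx].
  - exact: measurable_funN.
  - by rewrite normrN.
  - by rewrite -opprD normrN; exact: he.
have -> : \int[mu]_x - h x = - \int[mu]_x h x.
  rewrite -mulN1r -RintegralZl//; last exact: bounded_integrable hB.
  by under [RHS]eq_Rintegral do rewrite mulN1r.
by rewrite sumrN mulrN; lra.
Qed.
End mean_values.

(** * Trigonometric polynomials on the torus *)

Section trig_polynomials.
Variables (R : realType) (d : nat).
Local Notation T := (d.-tuple (measurableTypeR R)).
Local Notation mu := (torus_measure R d).
Local Notation C := R[i].
Local Notation freq := (d.-tuple int).
Implicit Types (S : seq freq) (c : freq -> C) (r : freq) (x y : T).

Definition trig_sum S c : cfun R d := fun x => \sum_(r <- S) c r * character r x.

Lemma nm_character r x : nm (character r x) = 1.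
Proof. exact: nm_expi. Qed.

Lemma exists_mesh (L e : R) N0 : 0 < e -> exists2 N, (N0 <= N)%N & L / (2 ^ N)%:R < e.
Proof.
move=> e0; pose n := Num.trunc (`|L| / e); exists (maxn N0 n.+1); first exact: leq_maxl.
set N := maxn _ _.
have h : `|L| / e < (2 ^ N)%:R.
  have h1 : `|L| / e < n.+1%:R by exact: truncnS_gt.
  apply: (lt_le_trans h1); rewrite ler_nat.
  by apply: (leq_trans (ltnW (ltn_expl n.+1 (isT : (1 < 2)%N)))); rewrite leq_exp2l// leq_maxr.
rewrite ltr_pdivrMr ?ltr0n ?expn_gt0//; rewrite ltr_pdivrMr// in h.
by rewrite (le_lt_trans (ler_norm _))// mulrC.
Qed.

Lemma trig_sum_Lipschitz S c : exists2 L : R, 0 <= L &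
  forall x y (e : R), (forall j, `|(tnth x j : R) - tnth y j| <= e) ->
    nm (trig_sum S c x - trig_sum S c y) <= L * e.
Proof.
exists (\sum_(r <- S) nm (c r) * (2 * pi * \sum_(j < d) `|(tnth r j)%:~R|)).
  by apply: sumr_ge0 => r _; rewrite mulr_ge0 ?nm_ge0// mulr_ge0 ?mulr_ge0 ?pi_ge0 ?sumr_ge0.
move=> x y e he; rewrite /trig_sum -sumrB (le_trans (nm_sum _ _ _))// mulr_suml ler_sum// => r _.
rewrite -mulrBr nmM -[leRHS]mulrA ler_wpM2l ?nm_ge0// (le_trans (nm_expi_Lip _ _))//.
rewrite /phase -mulrBr normrM ger0_norm ?mulr_ge0 ?pi_ge0// -[leRHS]mulrA.
rewrite ler_wpM2l ?mulr_ge0 ?pi_ge0// -sumrB (le_trans (ler_norm_sum _ _ _))//.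
rewrite mulr_suml ler_sum// => j _.
by rewrite -mulrBr normrM ler_wpM2l.
Qed.

Lemma trig_sum_bounded S c : exists B : R, forall x, nm (trig_sum S c x) <= B.
Proof.
exists (\sum_(r <- S) nm (c r)) => x.
rewrite (le_trans (nm_sum _ _ _))// ler_sum// => r _.
by rewrite nmM nm_character mulr1.
Qed.

Lemma trig_sum_periodic S c x y :
  (forall j, exists k : int, (tnth x j : R) = tnth y j + k%:~R) -> trig_sum S c x = trig_sum S c y.
Proof.
move=> /choice[k hk]; apply: eq_bigr => r _; congr (_ * _).
rewrite /character.
have -> : phase r x = phase r y + 2 * pi * (\sum_(j < d) tnth r j * k j)%:~R.
  rewrite /phase rmorph_sum/= -mulrDr -big_split/=; congr (_ * _).
  by apply: eq_bigr => j _; rewrite hk mulrDr intrM.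
by rewrite expiD expi_2pi mulr1.
Qed.

Lemma measurable_phase r : measurable_fun [set: T] (phase r : T -> R).
Proof.
apply: measurable_funM => //; apply: measurable_sum => j.
by apply: measurable_funM => //; exact: measurable_tnth.
Qed.

Lemma measurable_trig_sum S c :
  measurable_fun [set: T] (fun x => complex.Re (trig_sum S c x)) /\
  measurable_fun [set: T] (fun x => complex.Im (trig_sum S c x)).
Proof.
have mcos r : measurable_fun [set: T] (fun x => cos (phase r x)).
  apply: measurableT_comp; last exact: measurable_phase.
  by apply: continuous_measurable_fun; exact: continuous_cos.
have msin r : measurable_fun [set: T] (fun x => sin (phase r x)).
  apply: measurableT_comp; last exact: measurable_phase.
  by apply: continuous_measurable_fun; exact: continuous_sin.
split.
- have -> : (fun x => complex.Re (trig_sum S c x)) = (fun x => \sum_(r <- S)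
      (complex.Re (c r) * cos (phase r x) - complex.Im (c r) * sin (phase r x))).
    apply/funext => x; rewrite raddf_sum/=; apply: eq_bigr => r _.
    by rewrite /character /expi; case: (c r).
  apply: measurable_sum => r.
  by apply: measurable_funB; apply: measurable_funM.
- have -> : (fun x => complex.Im (trig_sum S c x)) = (fun x => \sum_(r <- S)
      (complex.Re (c r) * sin (phase r x) + complex.Im (c r) * cos (phase r x))).
    apply/funext => x; rewrite raddf_sum/=; apply: eq_bigr => r _.
    by rewrite /character /expi; case: (c r).
  apply: measurable_sum => r.
  by apply: measurable_funD; apply: measurable_funM.
Qed.

Lemma measurable_nm_trig_sum S c : measurable_fun [set: T] (fun x => nm (trig_sum S c x)).
Proof.
have [mre mim] := measurable_trig_sum S c.
have -> : (fun x => nm (trig_sum S c x)) =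
    (fun x => (complex.Re (trig_sum S c x) ^+ 2 + complex.Im (trig_sum S c x) ^+ 2) `^ 2^-1).
  by apply/funext => x; rewrite powR12_sqrt ?addr_ge0 ?sqr_ge0//
    -nm_sqr sqrtr_sqr ger0_norm ?nm_ge0.
apply: (measurableT_comp (measurable_powR _)).
by apply: measurable_funD; exact: measurable_funX.
Qed.

Lemma Re_Im_le (z : C) : `|complex.Re z| <= nm z /\ `|complex.Im z| <= nm z.
Proof.
split; rewrite -(@ler_pXn2r _ 2)// ?nnegrE ?nm_ge0// nm_sqr real_normK ?num_real//.
  by rewrite lerDl sqr_ge0.
by rewrite lerDr sqr_ge0.
Qed.

(** By continuity, a larger value would persist on a small mesh box, which has
    positive measure. *)
Lemma trig_sum_le_esssup S c (a : R) x :
  (torus_norm +oo (trig_sum S c) <= a%:E)%E -> nm (trig_sum S c x) <= a.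
Proof.
rewrite /torus_norm unlock.
have -> : (0 < mu [set: T])%E by rewrite probability_setT.
move=> /ess_supP hae.
(* By periodicity the point may be taken in the unit cube. *)
pose x' : T := [tuple (tnth x j : R) - (Num.floor (tnth x j : R))%:~R | j < d].
have -> : trig_sum S c x = trig_sum S c x'.
  apply: trig_sum_periodic => j; exists (Num.floor (tnth x j : R)).
  by rewrite tnth_mktuple subrK.
have cx : unit_cube x'.
  move=> j /=; rewrite tnth_mktuple in_itv/=.
  have /andP[h1 h2] := floor_itv (tnth x j : R).
  by rewrite subr_ge0 h1 ltrBlDl; move: h2; rewrite intrD.
move: x' cx => {}x cx.
rewrite leNgt; apply/negP => ax.
have [L L0 hL] := trig_sum_Lipschitz S c.
have [N _ hN] := @exists_mesh L (nm (trig_sum S c x) - a) 0 ltac:(lra).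
have [j jx] := mesh_cover N cx.
have jy y : mesh_box j y -> a < nm (trig_sum S c y).
  move=> yj; have dxy i : `|(tnth x i : R) - tnth y i| <= (2 ^ N)%:R^-1.
    have := jx i; have := yj i; rewrite /= !in_itv/= -natr1 mulrDl mul1r.
    by move=> /andP[? ?] /andP[? ?]; rewrite ler_norml; apply/andP; split; lra.
  have := hL _ _ _ dxy.
  have : nm (trig_sum S c x) <= nm (trig_sum S c x - trig_sum S c y) + nm (trig_sum S c y).
    by rewrite -{1}(subrK (trig_sum S c y) (trig_sum S c x)) nmD.
  by lra.
have [A [mA A0 hA]] := hae.
have : (mu (mesh_box j) <= mu A)%E.
  apply: le_measure; rewrite ?inE//; first exact: measurable_mesh_box.
  move=> y /jy ay; apply: hA => /=.
  by rewrite lee_fin ger0_norm ?nm_ge0// => /(lt_le_trans ay); rewrite ltxx.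
rewrite A0 [X in (X <= _)%E]mesh_box_measure lee_fin leNgt => /negP; apply.
by rewrite invr_gt0 ltr0n card_ffun !card_ord !expn_gt0.
Qed.
End trig_polynomials.

(** * Fourier coefficients and Littlewood-Paley projections *)

Section fourier.
Variables (R : realType) (d : nat).
Local Notation T := (d.-tuple (measurableTypeR R)).
Local Notation mu := (torus_measure R d).
Local Notation C := R[i].
Local Notation freq := (d.-tuple int).
Implicit Types (S : seq freq) (c : freq -> C) (r : freq) (x y : T).

Lemma expi_sum (I : Type) (s : seq I) (t : I -> R) :
  expi (\sum_(i <- s) t i) = \prod_(i <- s) expi (t i).
Proof. exact: (big_morph (@expi R) (@expiD R) (@expi0 R)). Qed.

Lemma character_sample N r (x : 'I_d -> nat) :
  character r (sample R N x) = \prod_(i < d) cchar R (2 ^ N) (tnth r i * (x i)%:Z).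
Proof.
rewrite /character /phase mulr_sumr expi_sum; apply: eq_bigr => i _.
by rewrite /cchar tnth_mktuple intrM -pmulrn; congr expi; ring.
Qed.

Lemma mesh_mean_character N r : (forall i, `|tnth r i|%N < 2 ^ N)%N ->
  #|{: {ffun 'I_d -> 'I_(2 ^ N)}}|%:R^-1 *
    \sum_(j : {ffun 'I_d -> 'I_(2 ^ N)}) character r (sample R N (grid_pt j)) =
  (if [forall i, tnth r i == 0] then 1 else 0 : C).
Proof.
move=> rN; have M0 : (0 < 2 ^ N)%N by rewrite expn_gt0.
under eq_bigr do rewrite character_sample /grid_pt.
have := bigA_distr_bigA (times := *%R) (plus := +%R)
  (fun (i : 'I_d) (y : 'I_(2 ^ N)) => cchar R (2 ^ N) (tnth r i * y%:Z)).
move=> <-; case: ifPn => [/forallP r0|/forallPn[i ri]].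
  under eq_bigr => i _.
    rewrite (eqP (r0 i)); under eq_bigr do rewrite mul0r cchar0.
    rewrite sumr_const card_ord; over.
  by rewrite prodr_const card_ord card_ffun !card_ord (natrX _ (2 ^ N) d) mulVf.
rewrite (bigD1 i)//= sum_cchar0 ?mul0r ?mulr0// rN andbT.
by rewrite absz_gt0.
Qed.

Definition freq_sub r r' : freq := [tuple tnth r i - tnth r' i | i < d].
Definition freq_add r r' : freq := [tuple tnth r i + tnth r' i | i < d].

Lemma freq_subK r r' : freq_add (freq_sub r r') r' = r.
Proof. by apply: eq_from_tnth => i; rewrite !tnth_mktuple subrK. Qed.

Lemma freq_sub_eq0 r r' : [forall i, tnth (freq_sub r r') i == 0] = (r == r').
Proof.
apply/forallP/eqP => [H|-> i]; last by rewrite tnth_mktuple subrr.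
apply: eq_from_tnth => i; apply/eqP; rewrite -subr_eq0.
by have := H i; rewrite tnth_mktuple.
Qed.

Lemma trig_sum_modulate S c r x : trig_sum S c x * expi (- phase r x) =
  trig_sum [seq freq_sub r' r | r' <- S] (fun r' => c (freq_add r' r)) x.
Proof.
rewrite /trig_sum mulr_suml big_map; apply: eq_bigr => r' _.
rewrite freq_subK -mulrA /character -expiD; congr (_ * expi _).
rewrite /phase -mulrN -mulrDr -sumrN -big_split/=; congr (_ * _).
by apply: eq_bigr => i _; rewrite tnth_mktuple intrB; ring.
Qed.

Lemma freq_bound S : exists N, forall r, r \in S -> forall i, (`|tnth r i| < 2 ^ N)%N.
Proof.
elim: S => [|r S [N hN]]; first by exists 0%N.
have [N1 hN1] : exists N1, forall i, (`|tnth r i| < 2 ^ N1)%N.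
  exists (\max_(i < d) `|tnth r i|)%N => i.
  by apply: (leq_ltn_trans _ (ltn_expl _ _)) => //; exact: (leq_bigmax_cond i).
exists (maxn N N1) => r'; rewrite inE => /orP[/eqP ->|r'S] i.
  by apply: (leq_trans (hN1 i)); rewrite leq_exp2l// leq_maxr.
by apply: (leq_trans (hN _ r'S i)); rewrite leq_exp2l// leq_maxl.
Qed.

(** On fine meshes the mean equals the constant coefficient exactly, and the
    means converge to the integral. *)
Lemma torus_integral_trig_sum S c :
  torus_integral (trig_sum S c) = \sum_(r <- S | [forall i, tnth r i == 0]) c r.
Proof.
set a := \sum_(r <- S | _) c r.
have [N0 hN0] := freq_bound S.
have mean N : (N0 <= N)%N -> #|{: {ffun 'I_d -> 'I_(2 ^ N)}}|%:R^-1 *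
    \sum_(j : {ffun 'I_d -> 'I_(2 ^ N)}) trig_sum S c (sample R N (grid_pt j)) = a.
  move=> NN; rewrite /trig_sum exchange_big/= mulr_sumr /a [RHS]big_mkcond/=.
  rewrite big_seq [RHS]big_seq; apply: eq_bigr => r rS.
  rewrite -mulr_sumr mulrCA mesh_mean_character.
    by case: ifP => _; rewrite ?mulr1 ?mulr0.
  by move=> i; apply: (leq_trans (hN0 _ rS i)); rewrite leq_exp2l.
have [L L0 hL] := trig_sum_Lipschitz S c.
have [B hB] := trig_sum_bounded S c.
have [mre mim] := measurable_trig_sum S c.
have close (h : C -> R) : {morph h : z w / z + w} ->
    (forall (t : R) z, h ((t%:C)%C * z) = t * h z) ->
    h 0 = 0 -> (forall z w, h (z - w) = h z - h w) ->
    (forall z, `|h z| <= nm z) ->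
    measurable_fun [set: T] (fun x => h (trig_sum S c x)) ->
    \int[mu]_x h (trig_sum S c x) = h a.
  move=> hD hZ h0 hsub hle mh; apply/eqP; rewrite -subr_eq0 -normr_le0 leNgt; apply/negP => e0.
  have [N NN hN] := exists_mesh L N0 e0.
  have := @integral_mesh_mean R d N (fun x => h (trig_sum S c x)) B (L / (2 ^ N)%:R) mh _ _.
  set A := (X in `|_ - X|); have -> : A = h a.
    rewrite /A -(mean N NN) (_ : #|_|%:R^-1 = ((#|{: {ffun 'I_d -> 'I_(2 ^ N)}}|%:R^-1)%:C)%C).
      by rewrite hZ (big_morph h hD h0).
    by rewrite fmorphV rmorph_nat.
  move=> H; have : `|\int[mu]_x h (trig_sum S c x) - h a| <= L / (2 ^ N)%:R.
    apply: H => [x|j x jx]; first exact: le_trans (hle _) (hB x).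
    rewrite -hsub; apply: le_trans (hle _) _; apply: hL => i.
    exact: mesh_sample_dist.
  by rewrite leNgt hN.
apply/eqP; rewrite eq_complex/=; apply/andP; split; apply/eqP.
- apply: close => //; first exact: raddfD.
  + by move=> t [u v]; rewrite /= mul0r subr0.
  + by move=> z w; rewrite raddfB.
  + by move=> z; case: (Re_Im_le z).
- apply: close => //; first exact: raddfD.
  + by move=> t [u v]; rewrite /= mul0r addr0.
  + by move=> z w; rewrite raddfB.
  + by move=> z; case: (Re_Im_le z).
Qed.

Lemma fourier_coef_trig_sum S c r : fourier_coef (trig_sum S c) r = \sum_(r' <- S | r' == r) c r'.
Proof.
rewrite /fourier_coef.
have -> : (fun x => trig_sum S c x * expi (- phase r x)) =
    trig_sum [seq freq_sub r' r | r' <- S] (fun r' => c (freq_add r' r)).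
  by apply/funext => x; exact: trig_sum_modulate.
rewrite torus_integral_trig_sum big_map; apply: eq_big => r'; first exact: freq_sub_eq0.
by rewrite freq_subK.
Qed.

Definition lp_symbol (eta : R -> C) (k : d.-tuple nat) r : C :=
  \prod_(j < d) lp_cutoff eta (tnth k j) (tnth r j)%:~R.

Lemma lp_proj_trig_sum eta k S c :
  lp_proj eta k (trig_sum S c) = trig_sum S (fun r => lp_symbol eta k r * c r).
Proof.
apply/funext => x; rewrite /lp_proj (fsbigE (undup S)) ?undup_uniq//; last first.
  move=> r _; rewrite mem_undup fourier_coef_trig_sum => rS.
  have -> : \sum_(r' <- S | r' == r) c r' = 0.
    rewrite big_seq_cond big1// => r' /andP[r'S /eqP e].
    by rewrite -e r'S in rS.
  by rewrite mulr0 mul0r.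
rewrite (eq_bigl xpredT) => [|r]; last exact: mem_set.
transitivity (\sum_(r <- undup S) \sum_(r' <- S | r' == r)
    lp_symbol eta k r' * c r' * character r' x).
  apply: eq_bigr => r _; rewrite fourier_coef_trig_sum mulr_sumr mulr_suml.
  by apply: eq_bigr => r' /eqP ->.
rewrite (exchange_big_dep xpredT)//= /trig_sum big_seq [RHS]big_seq.
apply: eq_bigr => r rS; rewrite -big_filter (_ : [seq _ <- _ | _] = [:: r]) ?big_seq1//.
by rewrite (eq_filter (a2 := pred1 r)) ?filter_pred1_uniq ?undup_uniq ?mem_undup.
Qed.

Lemma sliced_band_trig_sum N (j : 'I_d) lo hi S c :
  (forall r, r \in S -> c r != 0 -> (lo <= `|tnth r j| <= hi)%N) ->
  forall x : 'I_d -> nat,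
    band (2 ^ N) lo hi (fun n => trig_sum S c (sample R N (upd x j n))).
Proof.
move=> hc x.
pose w r := c r * \prod_(i < d | i != j) cchar R (2 ^ N) (tnth r i * (x i)%:Z).
exists [seq (tnth r j, w r) | r <- S & c r != 0]; split=> [p|n].
  by move=> /mapP[r]; rewrite mem_filter => /andP[c0 rS] ->; exact: hc.
rewrite big_map big_filter /trig_sum big_mkcond/= [RHS]big_mkcond/=; apply: eq_bigr => r _.
case: eqP => [->|_]/=; first by rewrite mul0r.
rewrite character_sample (bigD1 j)//= upd_same /w -mulrA; congr (_ * _).
rewrite mulrC; congr (_ * _); apply: eq_bigr => i ij.
by rewrite upd_other.
Qed.
End fourier.

(** * From the grid to the torus *)

Section cutoffs.
Variables (R : realType) (eta : R -> R[i]).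
Hypothesis eta_supp : fun_support eta `<=` [set t | -2 < t < 2].
Hypothesis eta_eq1 : forall t : R, -1 <= t <= 1 -> eta t = 1.

Lemma eta_eq0 (t : R) : 2 <= `|t| -> eta t = 0.
Proof.
move=> t2; apply/eqP/negPn/negP => e0.
have /eta_supp/= : fun_support eta t by apply: subset_closure.
by rewrite -ltr_norml ltNge t2.
Qed.

Lemma lp_cutoff_band (k : nat) (r : int) : lp_cutoff eta k r%:~R != 0 ->
  ((if k is k'.+1 then 2 ^ k' else 0) <= `|r| <= 2 ^ k.+1)%N.
Proof.
have absr : `|r%:~R| = (`|r|%N)%:R :> R by rewrite -intr_norm -abszE -pmulrn.
have p0 n : 0 < 2 ^+ n :> R by rewrite exprn_gt0.
case: k => [|k] h.
  rewrite leq0n/= leqNgt; apply/negP => r2; move: h; rewrite /lp_cutoff eta_eq0 ?eqxx//.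
  by rewrite absr -[2]/(2%:R) ler_nat ltnW.
apply/andP; split; rewrite leqNgt; apply/negP => rk; move: h; rewrite /lp_cutoff /lp_phi.
  have hr : `|r%:~R| <= 2 ^+ k :> R by rewrite absr -natrX ler_nat ltnW.
  have {}hr : `|2 ^- k.+1 * r%:~R| <= 2^-1 :> R.
    rewrite normrM ger0_norm ?invr_ge0 ?exprn_ge0// ler_pdivrMl// exprS.
    by rewrite [leRHS](_ : _ = 2 ^+ k) //; field.
  rewrite !eta_eq1 ?subrr ?eqxx//; move: hr; rewrite ler_norml => /andP[? ?];
    by apply/andP; split; lra.
have hr : 2 ^+ k.+2 <= `|r%:~R| :> R by rewrite absr -natrX ler_nat ltnW.
have {}hr : 2 <= `|2 ^- k.+1 * r%:~R| :> R.
  rewrite normrM ger0_norm ?invr_ge0 ?exprn_ge0// ler_pdivlMl// mulrC -exprS.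
  exact: hr.
by rewrite !eta_eq0 ?subrr ?eqxx// normrM ger0_norm//; lra.
Qed.

Lemma lp_cutoff_telescope K (xi : R) :
  \sum_(k < K.+1) lp_cutoff eta k xi = eta (2 ^- K * xi).
Proof.
elim: K => [|K IH]; first by rewrite big_ord1 expr0 invr1 mul1r.
rewrite big_ord_recr/= IH /lp_phi.
have -> : 2 * (2 ^- K.+1 * xi) = 2 ^- K * xi.
  by rewrite mulrA exprS invfM mulrA divff// mul1r.
by rewrite addrCA subrr addr0.
Qed.

Lemma lp_cutoff_sum K (r : int) : (`|r| < 2 ^ K)%N ->
  \sum_(k < K.+1) lp_cutoff eta k r%:~R = 1.
Proof.
move=> rK; rewrite lp_cutoff_telescope eta_eq1// -ler_norml.
rewrite normrM ger0_norm ?invr_ge0 ?exprn_ge0// ler_pdivrMl ?exprn_gt0// mulr1.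
by rewrite -intr_norm -abszE -pmulrn -natrX ler_nat ltnW.
Qed.

Variable d : nat.

Definition nat_index K (k : d.-tuple 'I_K) : d.-tuple nat := map_tuple (@nat_of_ord K) k.

Lemma nat_index_inj K : injective (@nat_index K).
Proof.
move=> k1 k2 /(congr1 val)/= e; apply: val_inj.
by apply: (inj_map (@ord_inj K)) e.
Qed.

Lemma lp_symbol_sum K (r : d.-tuple int) : (forall j, `|tnth r j| < 2 ^ K)%N ->
  \sum_(k : d.-tuple 'I_K.+1) lp_symbol eta (nat_index k) r = 1.
Proof.
move=> rK.
transitivity (\prod_(j < d) \sum_(k < K.+1) lp_cutoff eta k (tnth r j)%:~R); last first.
  by rewrite big1// => j _; exact: lp_cutoff_sum.
rewrite bigA_distr_bigA/=.
rewrite [RHS](reindex (fun k : d.-tuple 'I_K.+1 => [ffun j => tnth k j]))/=.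
  apply: eq_bigr => k _; apply: eq_bigr => j _.
  by rewrite /nat_index tnth_map ffunE.
exists (fun f : {ffun 'I_d -> 'I_K.+1} => [tuple f j | j < d]) => [k _|f _].
  by apply: eq_from_tnth => j; rewrite tnth_mktuple ffunE.
by apply/ffunP => j; rewrite ffunE tnth_mktuple.
Qed.

Lemma trig_sum_decomposition (S : seq (d.-tuple int)) c : exists K0, forall K x, (K0 <= K)%N ->
  trig_sum S c x = \sum_(k : d.-tuple 'I_K.+1)
    trig_sum S (fun r => lp_symbol eta (nat_index k) r * c r) x.
Proof.
have [K0 hK0] := freq_bound S; exists K0 => K x KK.
rewrite /trig_sum exchange_big/= big_seq [RHS]big_seq; apply: eq_bigr => r rS.
under eq_bigr do rewrite -mulrA.
rewrite -mulr_suml lp_symbol_sum ?mul1r// => j.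
by apply: (leq_trans (hK0 _ rS j)); rewrite leq_exp2l.
Qed.
End cutoffs.

Section sampling.
Variables (R : realType) (d : nat).
Local Notation T := (d.-tuple (measurableTypeR R)).
Local Notation mu := (torus_measure R d).

Lemma wnorm_sqr (J : finType) (c p : R) (h : J -> R) : 0 <= c -> 0 < p -> (forall x, 0 <= h x) ->
  wnorm c p h = wnorm c (p / 2) (fun x => h x ^+ 2) `^ 2^-1.
Proof.
move=> c0 p0 h0; rewrite /wnorm -powRrM.
have -> : (p / 2)^-1 * 2^-1 = p^-1 by field; rewrite gt_eqF.
congr (_ `^ _); congr (_ * _); apply: eq_bigr => x _.
by rewrite -powR_mulrn// -powRrM mulrC divfK.
Qed.

(** On a fine mesh the function differs by at most [e] from its sample on each
    box. *)
Lemma torus_norm_le_gnorm (S : seq (d.-tuple int)) (c : d.-tuple int -> R[i])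
  (p e : R) N0 : 2 < p -> 0 < e ->
  exists2 N, (N0 <= N)%N &
    (torus_norm p%:E (trig_sum S c) <=
      (gnorm N p (fun x => trig_sum S c (sample R N x)) `^ 2^-1 + e)%:E)%E.
Proof.
move=> p2 e0; have [L L0 hL] := trig_sum_Lipschitz S c.
have [N NN hN] := exists_mesh L N0 e0; exists N => //.
pose J := {ffun 'I_d -> 'I_(2 ^ N)}.
pose F (j : J) : R := nm (trig_sum S c (sample R N (grid_pt j))).
have F0 j : 0 <= F j by exact: nm_ge0.
have c0 : 0 <= #|J|%:R^-1 :> R by rewrite invr_ge0.
have p0 : 0 < p by lra.
have -> : gnorm N p (fun x => trig_sum S c (sample R N x)) `^ 2^-1 = wnorm #|J|%:R^-1 p F.
  by rewrite wnorm_sqr.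
have W : wnorm #|J|%:R^-1 p (fun j => F j + e) <= wnorm #|J|%:R^-1 p F + e.
  have h1 : 1 <= p by lra.
  have := @wnormD R J _ c0 p F (fun=> e) h1 F0 (fun=> ltW e0).
  have -> : wnorm #|J|%:R^-1 p (fun _ : J => e) = e; last by [].
  rewrite /wnorm sumr_const -[X in _ * X]mulr_natl mulKf; last first.
    by rewrite pnatr_eq0 -lt0n card_ffun !card_ord !expn_gt0.
  by rewrite -powRrM mulfV ?gt_eqF// powRr1// ltW.
apply: (@le_trans _ _ (wnorm #|J|%:R^-1 p (fun j => F j + e))%:E); last by rewrite lee_fin.
rewrite /torus_norm unlock.
have I0 : (\int[mu]_x (`|(nm (trig_sum S c x))%:E| `^ p) <=
    (#|J|%:R^-1 * \sum_(j : J) (F j + e) `^ p)%:E)%E.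
  under eq_integral => x _ do rewrite abse_EFin ger0_norm ?nm_ge0// poweR_EFin.
  apply: integral_le_mesh.
  - by apply: (measurableT_comp (measurable_powR _)); exact: measurable_nm_trig_sum.
  - by move=> x; exact: powR_ge0.
  - by move=> j; exact: powR_ge0.
  - move=> j x jx.
    have Fe : 0 <= F j + e by rewrite addr_ge0// ltW.
    apply: ge0_ler_powR; rewrite ?nnegrE ?nm_ge0 ?(ltW p0)//.
    have := hL _ _ _ (fun i => mesh_sample_dist i jx).
    have : nm (trig_sum S c x) <= nm (trig_sum S c x - trig_sum S c (sample R N (grid_pt j))) + F j.
      by rewrite -{1}(subrK (trig_sum S c (sample R N (grid_pt j))) (trig_sum S c x)) nmD.
    move=> h1 h2; apply: (le_trans h1); rewrite addrC lerD2l.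
    by apply: (le_trans h2); exact: ltW.
have Y (y : \bar R) : (0 <= y)%E -> y \in `[0%E, +oo%E].
  by move=> y0; rewrite in_itv/= leey andbT.
rewrite /wnorm -poweR_EFin; apply: gt0_ler_poweR => //.
- by rewrite invr_ge0 ltW.
- by apply: Y; apply: integral_ge0 => x _; exact: poweR_ge0.
- by apply: Y; rewrite lee_fin mulr_ge0// sumr_ge0// => j _; exact: powR_ge0.
Qed.
End sampling.

Theorem proposition3 (R : realType) (d : nat) (d_gt0 : (0 < d)%N)
    (eta : R -> R[i])
    (eta_schwartz : schwartz eta)
    (eta_supp : fun_support eta `<=` [set t | -2 < t < 2])
    (eta_eq1 : forall t : R, -1 <= t <= 1 -> eta t = 1) :
  exists C : R, 0 < C /\
    forall f : cfun R d, trig_poly f ->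
    forall p : R, 2 < p ->
      (torus_norm p%:E f <=
        (C * p `^ (d%:R / 2))%:E *
        (\esum_(k in [set: d.-tuple nat])
           torus_norm +oo (lp_proj eta k f) ^+ 2) `^ 2^-1)%E.
Proof.
(* Per variable: [11 * p] from the martingale inequality, [140] from the decay
   of the differences, and [9] from Schur's test. *)
pose D : R := (11 * (9 * 140 ^+ 2)) ^+ d.
have D0 : 0 < D by rewrite exprn_gt0// !mulr_gt0.
exists (D `^ 2^-1); split; first exact: powR_gt0.
move=> f [S [c fE]] p p2; have {fE} -> : f = trig_sum S c by apply/funext.
set E := \esum_(k in _) _.
have p0 : 0 < p by lra.
have E0 : (0 <= E)%E by apply: esum_ge0 => k _; exact: sqre_ge0.
have Cp : 0 < D `^ 2^-1 * p `^ (d%:R / 2) by rewrite mulr_gt0// powR_gt0.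
have [Ey|Efin] := eqVneq E +oo%E.
  by rewrite Ey poweRyr ?invr_eq0 ?pnatr_eq0// gt0_muley ?lte_fin// leey.
have termE k : (torus_norm +oo (lp_proj eta k (trig_sum S c)) ^+ 2 <= E)%E.
  apply: esum_ge; exists [set k]; last by rewrite fsbig_set1.
  by split.
have Elty : (E < +oo)%E by rewrite ltey.
have nfin k : torus_norm +oo (lp_proj eta k (trig_sum S c)) \is a fin_num.
  rewrite ge0_fin_numE ?Lnorm_ge0//.
  rewrite ltey; apply/negP => /eqP ky; have := le_lt_trans (termE k) Elty.
  by rewrite ky.
pose a k := fine (torus_norm +oo (lp_proj eta k (trig_sum S c))).
have [K0 hK0] := trig_sum_decomposition eta_eq1 S c.
have Ef : E = (fine E)%:E by rewrite fineK// ge0_fin_numE.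
have suma K : \sum_(k : d.-tuple 'I_K) a (nat_index k) ^+ 2 <= fine E.
  rewrite -lee_fin -Ef; apply: esum_ge.
  exists [set` [seq nat_index k | k : d.-tuple 'I_K]].
    by split; [exact: finite_seq|].
  rewrite -fsbig_seq; last by rewrite map_inj_uniq ?enum_uniq//; exact: nat_index_inj.
  rewrite big_map big_enum/= -sumEFin; apply: lee_sum => k _.
  by rewrite /a EFin_expe fineK.
apply/lee_addgt0Pr => e e0.
have [N NN hN] := torus_norm_le_gnorm S c (K0.+1 + 2) p2 e0.
apply: (le_trans hN); rewrite EFinD leeD2r//.
rewrite Ef poweR_EFin -EFinM lee_fin.
have -> : D `^ 2^-1 * p `^ (d%:R / 2) * fine E `^ 2^-1 =
    ((11 * p * (9 * 140 ^+ 2)) ^+ d * fine E) `^ 2^-1.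
  have fE0 : 0 <= fine E by rewrite fine_ge0.
  have -> : (11 * p * (9 * 140 ^+ 2)) ^+ d = D * p ^+ d.
    by rewrite /D -exprMn; congr (_ ^+ _); ring.
  rewrite !powRM ?exprn_ge0 ?mulr_ge0 ?exprn_ge0 ?(ltW p0) ?(ltW D0)//.
  by rewrite -(powR_mulrn _ (ltW p0)) -powRrM.
have -> : (fun x => trig_sum S c (sample R N x)) = (fun x => \sum_(k : d.-tuple 'I_K0.+1)
    trig_sum S (fun r => lp_symbol eta (nat_index k) r * c r) (sample R N x)).
  by apply/funext => x; exact: hK0.
have G := @gnorm_bound R d N K0.+1 p
  (fun k x => trig_sum S (fun r => lp_symbol eta (nat_index k) r * c r) (sample R N x))
  (fun k => a (nat_index k)).
apply: ge0_ler_powR; rewrite ?invr_ge0 ?nnegrE ?gnorm_ge0//.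
- by rewrite mulr_ge0 ?exprn_ge0 ?mulr_ge0 ?(ltW p0) ?fine_ge0.
- apply: (le_trans (G _ _ _ _)); [exact: ltW|exact: NN| | |].
  + move=> k x; apply: trig_sum_le_esssup.
    by rewrite -lp_proj_trig_sum /a fineK.
  + move=> k j x; apply: sliced_band_trig_sum => r rS; rewrite mulf_eq0 negb_or => /andP[sy _].
    have := @lp_cutoff_band R eta eta_supp eta_eq1 (tnth k j) (tnth r j).
    apply; move: sy; rewrite /lp_symbol => /prodf_neq0/(_ j isT).
    by rewrite /nat_index tnth_map.
  + apply: ler_wpM2l (suma _).
    by rewrite exprn_ge0// !mulr_ge0// ltW.
Qed.
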